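(* Let $\mathcal{R}$ be an orthogonal, left-finite TRS and $\mathcal{B}$ the Böhm extension of $\mathcal{R}$ w.r.t. its root-active terms. Then $s$ strongly $p$-converges to $t$ in $\mathcal{R}$ (by some reduction) iff $s$ strongly $m$-converges to $t$ in $\mathcal{B}$.
   Context: Orthogonal = left-linear and non-overlapping; left-finite = all left-hand sides finite. Partial terms are terms over $\Sigma_\bot=\Sigma\uplus\{\bot\}$ ordered by $\le_\bot$ ($s\le_\bot t$ iff $s$ is $t$ with some subterms replaced by $\bot$), a complete semilattice; $\liminf_{\iota\to\alpha}a_\iota=\bigvee_{\beta<\alpha}\bigwedge_{\beta\le\iota<\alpha}a_\iota$. For a reduction $(t_\iota\to_{\pi_\iota}t_{\iota+1})_{\iota<\alpha}$ let $c_\iota$ be $t_\iota$ with position $\pi_\iota$ replaced by $\bot$; it strongly $p$-converges to $t$ if $\liminf_{\iota\to\lambda}c_\iota=t_\lambda$ for all limit $\lambda<\alpha$ and $t$ is the last term (closed case) or $t=\liminf_{\iota\to\alpha}c_\iota$ (open case). Strong $m$-convergence: the terms converge in the metric $d(s,t)=2^{-(\text{min. differing depth})}$ at every limit ordinal $\le\alpha$ (and to $t$ at the end) and the contraction depths $|\pi_\iota|$ tend to infinity at every limit ordinal (including $\alpha$ if open). A total term $t$ is root-active if for every finite reduction $t\to^*t'$ there is a finite reduction $t'\to^*s$ to a redex $s$; let $\mathcal{U}$ be the set of root-active terms. $\mathcal{U}_\bot$ is the set of partial terms having some instance in $\mathcal{U}$ obtained by replacing each $\bot$ by a term of $\mathcal{U}$.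 The Böhm extension is $\mathcal{B}=(\Sigma_\bot,R\cup\{t\to\bot\mid t\in\mathcal{U}_\bot\setminus\{\bot\}\})$, where $\bot$ is treated as an ordinary constant. *)

(* Defs.v *)
From Stdlib Require Import List Relations Arith.
Import ListNotations.
Set Implicit Arguments.

Section ITRS.
Variable F : Type.
Variable ar : F -> nat.

Inductive sym := Fn (f : F) | Vr (x : nat) | Bot.

Definition arity (a : sym) : nat := match a with Fn f => ar f | _ => 0 end.

(* positions: root-first paths; the children of p are p ++ [i] *)
Definition pos := list nat.

(* a (possibly infinite, partial) term is its labelling function *)
Definition term := pos -> option sym.

Definition wf (t : term) : Prop :=
  t [] <> None /\
  forall p i, t (p ++ [i]) <> None <-> exists a, t p = Some a /\ i < arity a.

Definition botterm : term := fun p => match p with [] => Some Bot | _ => None end.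

Definition total (t : term) : Prop := forall p, t p <> Some Bot.

Fixpoint graft (t : term) (h : pos -> sym -> option term) (q rest : pos)
  : option sym :=
  match t q with
  | None => None
  | Some a =>
      match h q a with
      | Some u => u rest
      | None => match rest with
                | [] => Some a
                | i :: rest' => graft t h (q ++ [i]) rest'
                end
      end
  end.

Definition subst (t : term) (sigma : nat -> term) : term :=
  fun p => graft t (fun _ a => match a with Vr x => Some (sigma x) | _ => None end) [] p.

Definition replace (t : term) (pi : pos) (u : term) : term :=
  fun p => graft t (fun q _ => if list_eq_dec Nat.eq_dec q pi then Some u else None) [] p.

Definition fill (t : term) (f : pos -> term) : term :=
  fun p => graft t (fun q a => match a with Bot => Some (f q) | _ => None end) [] p.

Definition subterm (t : term) (pi : pos) : term := fun q => t (pi ++ q).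

Definition rule := (term * term)%type.
Definition trs := rule -> Prop.

Definition is_trs (R : trs) : Prop :=
  forall l r, R (l, r) ->
    wf l /\ wf r /\ total l /\ total r /\ (forall x, l [] <> Some (Vr x)) /\
    (forall p x, r p = Some (Vr x) -> exists q, l q = Some (Vr x)).

Definition wf_subst (sigma : nat -> term) : Prop := forall x, wf (sigma x).

Definition step (R : trs) (t : term) (pi : pos) (t' : term) : Prop :=
  exists l r sigma, R (l, r) /\ wf_subst sigma /\ t pi <> None /\
    subterm t pi = subst l sigma /\ t' = replace t pi (subst r sigma).

Definition step1 (R : trs) (t t' : term) : Prop := exists pi, step R t pi t'.

Definition redex (R : trs) (t : term) : Prop :=
  exists l r sigma, R (l, r) /\ wf_subst sigma /\ t = subst l sigma.

Definition left_linear (R : trs) : Prop :=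
  forall l r, R (l, r) -> forall p q x, l p = Some (Vr x) -> l q = Some (Vr x) -> p = q.

Definition non_overlapping (R : trs) : Prop :=
  forall l1 r1 l2 r2 pi f, R (l1, r1) -> R (l2, r2) -> l2 pi = Some (Fn f) ->
    (exists s1 s2, wf_subst s1 /\ wf_subst s2 /\
       subst l1 s1 = subst (subterm l2 pi) s2) ->
    pi = [] /\ (l1, r1) = (l2, r2).

Definition orthogonal (R : trs) : Prop := left_linear R /\ non_overlapping R.

Definition left_finite (R : trs) : Prop :=
  forall l r, R (l, r) -> exists n, forall p, n < length p -> l p = None.

Definition root_active (R : trs) (t : term) : Prop :=
  wf t /\ total t /\
  forall t', clos_refl_trans term (step1 R) t t' ->
    exists s, clos_refl_trans term (step1 R) t' s /\ redex R s.

Definition U_bot (R : trs) (u : term) : Prop :=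
  wf u /\ exists f : pos -> term,
    (forall p, u p = Some Bot -> root_active R (f p)) /\ root_active R (fill u f).

Definition bohm (R : trs) : trs :=
  fun ru => R ru \/ (U_bot R (fst ru) /\ fst ru <> botterm /\ snd ru = botterm).

Definition pleq (s t : term) : Prop :=
  forall p, s p = None \/ (s p = Some Bot /\ t p <> None) \/ s p = t p.

Definition is_glb (S : term -> Prop) (m : term) : Prop :=
  wf m /\ (forall v, S v -> pleq m v) /\
  (forall w, wf w -> (forall v, S v -> pleq w v) -> pleq w m).

Definition is_lub (S : term -> Prop) (m : term) : Prop :=
  wf m /\ (forall v, S v -> pleq v m) /\
  (forall w, wf w -> (forall v, S v -> pleq v w) -> pleq m w).

(* ordinals: well-ordered index types; option I = I + {alpha} *)
Record wellorder (I : Type) (lt : I -> I -> Prop) : Prop := {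
  wo_wf : well_founded lt;
  wo_trans : forall a b c, lt a b -> lt b c -> lt a c;
  wo_total : forall a b, lt a b \/ a = b \/ lt b a }.

Definition ltO (I : Type) (lt : I -> I -> Prop) (x y : option I) : Prop :=
  match x, y with
  | Some a, Some b => lt a b
  | Some _, None => True
  | None, _ => False
  end.

Definition leO (I : Type) (lt : I -> I -> Prop) (x y : option I) : Prop :=
  x = y \/ ltO lt x y.

Definition is_succ (I : Type) (lt : I -> I -> Prop) (x y : option I) : Prop :=
  ltO lt x y /\ forall z, ltO lt x z -> ltO lt z y -> False.

Definition is_limit (I : Type) (lt : I -> I -> Prop) (y : option I) : Prop :=
  (exists x, ltO lt x y) /\ forall x, ltO lt x y -> exists z, ltO lt x z /\ ltO lt z y.

Definition is_liminf (I : Type) (lt : I -> I -> Prop) (c : I -> term)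
  (lam : option I) (u : term) : Prop :=
  exists m : I -> term,
    (forall b, ltO lt (Some b) lam ->
       is_glb (fun v => exists i, leO lt (Some b) (Some i) /\ ltO lt (Some i) lam /\ v = c i) (m b)) /\
    is_lub (fun v => exists b, ltO lt (Some b) lam /\ v = m b) u.

(* a reduction of length alpha = order type of I: terms ts x for x <= alpha
   (ts None = the term at alpha), contraction positions ps i for i < alpha *)
Definition reduction (R : trs) (I : Type) (lt : I -> I -> Prop)
  (ts : option I -> term) (ps : I -> pos) : Prop :=
  wellorder lt /\ (forall x, wf (ts x)) /\
  forall i y, is_succ lt (Some i) y -> step R (ts (Some i)) (ps i) (ts y).

Definition starts_at (I : Type) (lt : I -> I -> Prop) (ts : option I -> term) (s : term) : Prop :=
  forall x, (forall y, leO lt x y) -> ts x = s.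

Definition p_conv (R : trs) (s t : term) : Prop :=
  exists (I : Type) (lt : I -> I -> Prop) (ts : option I -> term) (ps : I -> pos),
    reduction R lt ts ps /\ starts_at lt ts s /\ ts None = t /\
    forall lam, is_limit lt lam ->
      is_liminf lt (fun i => replace (ts (Some i)) (ps i) botterm) lam (ts lam).

Definition m_conv (R : trs) (s t : term) : Prop :=
  exists (I : Type) (lt : I -> I -> Prop) (ts : option I -> term) (ps : I -> pos),
    reduction R lt ts ps /\ starts_at lt ts s /\ ts None = t /\
    forall lam, is_limit lt lam ->
      forall n, exists b, ltO lt (Some b) lam /\
        forall i, leO lt (Some b) (Some i) -> ltO lt (Some i) lam ->
          (forall p, length p <= n -> ts (Some i) p = ts lam p) /\ n <= length (ps i).

End ITRS.

(* Main.v *)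
(* Both kinds of convergence from [s] to [t] are equivalent to one coinductive relation
   [red s t]: either [t] is bottom and [s] has a reduction with infinitely many root steps, or
   [s] reduces in finitely many steps of [R] to a term with the root symbol of [t], and the
   relation holds again between the children.

   [red] absorbs further steps on its right: by left-finiteness and left-linearity, a redex
   pattern in [t] is already produced from [s] by finitely many steps.  Steps to bottom of the
   Böhm extension are absorbed as well, because every term of U_bot reduces to bottom or has
   infinitely many root steps.  That, conversely, a term with infinitely many root steps lies
   in U_bot follows from a strip lemma for possibly infinite parallel steps.  Transfinite
   induction then shows that [red] absorbs entire reductions: at a limit ordinal a position is
   either eventually left alone, so that coinduction applies to its children, or it is
   contracted cofinally often, which gives infinitely many root steps and the value bottom.

   Conversely, [red s t] is realised by a reduction of length at most omega, which stabilises
   one more level in each stage and meanwhile performs one more root step at every position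
   where [t] is bottom.  In the Böhm extension such a position is instead sent to bottom by a
   single step. *)

From Stdlib Require Import List Arith Lia Relations.
From Stdlib Require Import Classical ClassicalEpsilon FunctionalExtensionality.
Require Import Defs.
Import ListNotations.
Set Implicit Arguments.
Unset Strict Implicit.

(** Right-hand sides may be infinite and may repeat variables, so a redex can have infinitely many
    residuals after a single step, and two finite reductions need not meet again after finitely many
    steps. The strip lemma therefore closes its diagrams with [lift (rootstep R)], which contracts
    any set of disjoint redexes at once. Such a step is never sequentialised: on the right of [red]
    it is absorbed coinductively, each redex being dealt with when the unfolding reaches it. This
    suffices to show that infinitely many root steps remain possible after every finite reduction,
    and root-activity asks about all finite reductions.

    [red] is [infred R inf_root]. The rewrite system and the collapse predicate are parameters
    because the Böhm side is [infred] of the extension with the empty predicate: there a collapse is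
    an ordinary step to a final root. One construction of an omega-sequence then yields both kinds
    of convergence. *)

Ltac splits := repeat match goal with |- _ /\ _ => split end.

(** * Terms *)

Section Rewriting.
Variable F : Type.
Variable ar : F -> nat.

Notation term := (term F).
Notation sym := (sym F).
Notation wf := (@wf F ar).
Notation arity := (@arity F ar).
Notation bot := (botterm F).

Lemma term_ext (t u : term) : (forall p, t p = u p) -> t = u.
Proof. intros H; apply functional_extensionality; exact H. Qed.

Definition sub (t : term) (i : nat) : term := fun p => t (i :: p).

Lemma subterm_nil (t : term) : subterm t [] = t.
Proof. reflexivity. Qed.

Lemma subterm_cons (t : term) i p : subterm t (i :: p) = subterm (sub t i) p.
Proof. reflexivity. Qed.

Lemma subterm_app (t : term) p q : subterm (subterm t p) q = subterm t (p ++ q).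
Proof. apply term_ext; intros r; unfold subterm; now rewrite app_assoc. Qed.

Lemma wf_root (t : term) : wf t -> exists a, t [] = Some a.
Proof. intros [H _]; destruct (t []) as [a|]; [now exists a | congruence]. Qed.

Lemma wf_child (t : term) i a : wf t -> t [] = Some a -> i < arity a -> wf (sub t i).
Proof.
  intros [H0 H] Ha Hi; split.
  - apply (H [] i); eauto.
  - intros p j; exact (H (i :: p) j).
Qed.

Lemma wf_out (t : term) i p a : wf t -> t [] = Some a -> arity a <= i -> t (i :: p) = None.
Proof.
  intros [_ H] Ha Hi. induction p as [|j p IH] using rev_ind.
  - destruct (t [i]) eqn:E; [|reflexivity]. exfalso.
    destruct (proj1 (H [] i)) as (b & Hb & Hlt); [cbn; congruence|].
    assert (b = a) by congruence; subst; lia.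
  - destruct (t (i :: p ++ [j])) eqn:E; [|reflexivity]. exfalso.
    destruct (proj1 (H (i :: p) j)) as (b & Hb & _); [cbn; congruence|].
    congruence.
Qed.

Lemma wf_intro (t : term) a : t [] = Some a ->
  (forall i, i < arity a -> wf (sub t i)) ->
  (forall i p, arity a <= i -> t (i :: p) = None) -> wf t.
Proof.
  intros Ha Hc Ho; split; [congruence|].
  intros [|j p] i; cbn.
  - split.
    + intros Hi. exists a; split; [assumption|].
      destruct (le_lt_dec (arity a) i); [|assumption].
      rewrite Ho in Hi by assumption; congruence.
    + intros (b & Hb & Hi). assert (b = a) by congruence; subst.
      exact (proj1 (Hc _ Hi)).
  - destruct (le_lt_dec (arity a) j) as [Hj|Hj].
    + rewrite !Ho by assumption. split; [congruence|].
      intros (b & Hb & _); congruence.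
    + exact (proj2 (Hc _ Hj) p i).
Qed.

(** Well-formedness speaks of one position at a time, so an invariant passed from a term to its
    children suffices, by induction on the position. For infinitely unfolded terms [wf_intro] would
    be circular. *)
Lemma wf_coind (X : term -> Prop) :
  (forall t, X t -> exists a, t [] = Some a /\
     (forall i, i < arity a -> X (sub t i)) /\
     (forall i p, arity a <= i -> t (i :: p) = None)) ->
  forall t, X t -> wf t.
Proof.
  intros HX t Ht; split.
  - destruct (HX t Ht) as (a & Ha & _); congruence.
  - intros p; revert t Ht; induction p as [|j p IH]; intros t Ht i;
      destruct (HX t Ht) as (a & Ha & Hc & Ho); cbn.
    + split.
      * intros Hi. exists a; split; [assumption|].
        destruct (le_lt_dec (arity a) i); [|assumption].
        rewrite Ho in Hi by assumption; congruence.
      * intros (b & Hb & Hi). assert (b = a) by congruence; subst.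
        destruct (HX _ (Hc _ Hi)) as (c & Hc' & _). unfold sub in Hc'; congruence.
    + destruct (le_lt_dec (arity a) j) as [Hj|Hj].
      * rewrite !Ho by assumption. split; [congruence|].
        intros (b & Hb & _); congruence.
      * exact (IH _ (Hc _ Hj) i).
Qed.

Lemma wf_subterm (t : term) p : wf t -> t p <> None -> wf (subterm t p).
Proof.
  revert t; induction p as [|i p IH]; intros t Ht Hp; [assumption|].
  destruct (wf_root Ht) as [a Ha].
  destruct (le_lt_dec (arity a) i) as [Hi|Hi].
  - rewrite (wf_out p Ht Ha Hi) in Hp; congruence.
  - exact (IH (sub t i) (wf_child Ht Ha Hi) Hp).
Qed.

Lemma subterm_root (t : term) p : subterm t p [] = t p.
Proof. unfold subterm; now rewrite app_nil_r. Qed.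

Lemma wf_subterm_defined (t : term) p : wf (subterm t p) -> t p <> None.
Proof. intros [H _]. now rewrite subterm_root in H. Qed.

Lemma wf_prefix (t : term) p q : wf t -> t (p ++ q) <> None -> t p <> None.
Proof.
  intros Ht; revert t Ht; induction p as [|i p IH]; cbn; intros t Ht Hp.
  - exact (proj1 Ht).
  - destruct (wf_root Ht) as [a Ha].
    destruct (le_lt_dec (arity a) i) as [Hi|Hi].
    + rewrite (wf_out (p ++ q) Ht Ha Hi) in Hp; congruence.
    + exact (IH (sub t i) (wf_child Ht Ha Hi) Hp).
Qed.

Lemma wf_leaf (t : term) p q a : wf t -> t p = Some a -> arity a = 0 -> q <> [] ->
  t (p ++ q) = None.
Proof.
  intros Ht Hp Ha Hq. destruct q as [|i q]; [congruence|].
  assert (Hs : wf (subterm t p)) by (apply wf_subterm; congruence).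
  refine (wf_out (a := a) q Hs _ _); [|lia].
  unfold subterm; rewrite app_nil_r; assumption.
Qed.

Lemma wf_bot : wf bot.
Proof. eapply wf_intro with (a := Bot F); cbn; [reflexivity| |]; intros; [lia|reflexivity]. Qed.

Definition var (x : nat) : term := fun p => match p with [] => Some (Vr F x) | _ => None end.

Lemma wf_var x : wf (var x).
Proof. eapply wf_intro with (a := Vr F x); cbn; [reflexivity| |]; intros; [lia|reflexivity]. Qed.

Lemma root_bot (t : term) : wf t -> t [] = Some (Bot F) -> t = bot.
Proof.
  intros Ht H0; apply term_ext; intros [|i p]; [assumption|].
  apply (wf_out p Ht H0); cbn; lia.
Qed.

Definition node (a : sym) (w : nat -> term) : term := fun p =>
  match p with
  | [] => Some a
  | i :: p' => if lt_dec i (arity a) then w i p' else None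
  end.

Lemma node_sub a w i : i < arity a -> sub (node a w) i = w i.
Proof.
  intros Hi; apply term_ext; intros p; unfold sub; cbn.
  destruct (lt_dec i (arity a)); [reflexivity|lia].
Qed.

Lemma wf_node a w : (forall i, i < arity a -> wf (w i)) -> wf (node a w).
Proof.
  intros H; apply wf_intro with (a := a); [reflexivity| |].
  - intros i Hi; rewrite node_sub by assumption; auto.
  - intros i p Hi; cbn. destruct (lt_dec i (arity a)); [lia|reflexivity].
Qed.

Lemma node_eta (t : term) a : wf t -> t [] = Some a -> node a (sub t) = t.
Proof.
  intros Ht Ha; apply term_ext; intros [|i p]; cbn; [congruence|].
  destruct (lt_dec i (arity a)); [reflexivity|].
  symmetry; apply (wf_out p Ht Ha); lia.
Qed.

Lemma node_ext a w w' : (forall i, i < arity a -> w i = w' i) -> node a w = node a w'.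
Proof.
  intros H; apply term_ext; intros [|i p]; cbn; [reflexivity|].
  destruct (lt_dec i (arity a)); [now rewrite H|reflexivity].
Qed.

Lemma total_sub (t : term) i : total t -> total (sub t i).
Proof. intros H p; exact (H (i :: p)). Qed.

(** * Grafting and substitution *)

Lemma graft_shift (t : term) h q rest :
  graft t h q rest = graft (subterm t q) (fun q' a => h (q ++ q') a) [] rest.
Proof.
  revert t h q; induction rest as [|i rest IH]; intros t h q; cbn;
    unfold subterm at 1; rewrite !app_nil_r; destruct (t q) as [a|]; try reflexivity.
  destruct (h q a); [reflexivity|].
  rewrite (IH t), (IH (subterm t q)). rewrite subterm_app.
  f_equal. repeat (apply functional_extensionality; intro). now rewrite app_assoc.
Qed.

(** [graft] accumulates the absolute position; moving the accumulator into the handler gives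
    recursion into the children. *)
Lemma graft_cons (t : term) h i p a : t [] = Some a -> h [] a = None ->
  graft t h [] (i :: p) = graft (sub t i) (fun q => h (i :: q)) [] p.
Proof. intros Ha Hh; cbn; rewrite Ha, Hh. apply graft_shift. Qed.

Lemma graft_id (t : term) p : wf t -> graft t (fun _ _ => None) [] p = t p.
Proof.
  revert t; induction p as [|i p IH]; intros t Ht.
  - cbn; destruct (t []); reflexivity.
  - destruct (wf_root Ht) as [a Ha]. rewrite graft_cons with (a := a) by auto.
    destruct (le_lt_dec (arity a) i) as [Hi|Hi].
    + rewrite (wf_out p Ht Ha Hi).
      assert (Hn : sub t i [] = None) by exact (wf_out [] Ht Ha Hi).
      destruct p; cbn; rewrite Hn; reflexivity.
    + exact (IH _ (wf_child Ht Ha Hi)).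
Qed.

(** Common form of [subst], which replaces variables, and of [fill] by a constant, which replaces
    bottoms. *)
Definition bind (k : sym -> option term) (t : term) : term :=
  fun p => graft t (fun _ a => k a) [] p.

Definition ksub (sigma : nat -> term) : sym -> option term :=
  fun a => match a with Vr _ x => Some (sigma x) | _ => None end.

Definition kbot (v : term) : sym -> option term :=
  fun a => match a with Bot _ => Some v | _ => None end.

Lemma subst_bind t sigma : subst t sigma = bind (ksub sigma) t.
Proof. reflexivity. Qed.

Lemma fill_bind t v : fill t (fun _ => v) = bind (kbot v) t.
Proof. reflexivity. Qed.

Lemma bind_hit k (t u : term) a : t [] = Some a -> k a = Some u -> bind k t = u.
Proof.
  intros Ha Hk; apply term_ext; intros p; unfold bind.
  destruct p; cbn; rewrite Ha, Hk; reflexivity.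
Qed.

Lemma bind_root k (t : term) a : t [] = Some a -> k a = None -> bind k t [] = Some a.
Proof. intros Ha Hk; unfold bind; cbn; now rewrite Ha, Hk. Qed.

Lemma bind_sub k (t : term) a i : t [] = Some a -> k a = None ->
  sub (bind k t) i = bind k (sub t i).
Proof.
  intros Ha Hk; apply term_ext; intros p; unfold bind, sub.
  now rewrite graft_cons with (a := a).
Qed.

Lemma bind_none k (t : term) p : t [] = None -> bind k t p = None.
Proof. intros H; unfold bind; destruct p; cbn; now rewrite H. Qed.

Lemma wf_bind k (t : term) : (forall a u, k a = Some u -> wf u) -> wf t -> wf (bind k t).
Proof.
  intros Hk Ht.
  apply (wf_coind (X := fun u => wf u \/ exists t, wf t /\ u = bind k t)); [|eauto].
  clear t Ht; intros u [Hu|(t & Ht & ->)].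
  - destruct (wf_root Hu) as [a Ha]; exists a; splits; [assumption| |].
    + intros i Hi; left; eapply wf_child; eauto.
    + intros i p Hi; eapply wf_out; eauto.
  - destruct (wf_root Ht) as [a Ha]. destruct (k a) as [v|] eqn:E.
    + rewrite (bind_hit Ha E). pose proof (Hk _ _ E) as Hv.
      destruct (wf_root Hv) as [b Hb]; exists b; splits; [assumption| |].
      * intros i Hi; left; eapply wf_child; eauto.
      * intros i p Hi; eapply wf_out; eauto.
    + exists a; splits.
      * now apply bind_root.
      * intros i Hi; right; exists (sub t i); split; [eapply wf_child; eauto|].
        eapply bind_sub; eauto.
      * intros i p Hi. change (sub (bind k t) i p = None).
        rewrite (bind_sub i Ha E). apply bind_none. exact (wf_out [] Ht Ha Hi).
Qed.

Lemma wf_subst_term (t : term) sigma : wf_subst ar sigma -> wf t -> wf (subst t sigma).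
Proof.
  intros Hs Ht; rewrite subst_bind; apply wf_bind; [|assumption].
  intros [f|x|] u; cbn; intros H; inversion H; subst; apply Hs.
Qed.

Lemma subst_var (t : term) sigma x : t [] = Some (Vr F x) -> subst t sigma = sigma x.
Proof. intros H; rewrite subst_bind; exact (bind_hit H eq_refl). Qed.

Lemma subst_fn_root (t : term) sigma f : t [] = Some (Fn f) -> subst t sigma [] = Some (Fn f).
Proof. intros H; rewrite subst_bind; exact (bind_root H eq_refl). Qed.

Lemma subst_fn_sub (t : term) sigma f i : t [] = Some (Fn f) ->
  sub (subst t sigma) i = subst (sub t i) sigma.
Proof. intros H; rewrite !subst_bind; exact (bind_sub i H eq_refl). Qed.

Lemma subst_none (t : term) sigma p : t [] = None -> subst t sigma p = None.
Proof. apply bind_none. Qed.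

Lemma subst_at (l : term) sigma p : wf l -> total l -> l p <> None ->
  subterm (subst l sigma) p = subst (subterm l p) sigma.
Proof.
  revert l; induction p as [|i p IH]; intros l Hl Ht Hp; [reflexivity|].
  destruct (wf_root Hl) as [a Ha].
  destruct (le_lt_dec (arity a) i) as [Hi|Hi].
  { rewrite (wf_out p Hl Ha Hi) in Hp; congruence. }
  destruct a as [f|x|]; [|cbn in Hi; lia..].
  rewrite !subterm_cons, (subst_fn_sub sigma i Ha).
  apply IH; [eapply wf_child; eauto|now apply total_sub|assumption].
Qed.

(** A total [l] has no bottoms and its variables are consumed by [tau], so [k] acts inside the
    substituted terms only. This makes rewrite steps stable under [bind]. *)
Lemma bind_subst k (l : term) tau : total l -> (forall f, k (Fn f) = None) ->
  bind k (subst l tau) = subst l (fun x => bind k (tau x)).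
Proof.
  intros Hl Hk; apply term_ext; intros p; revert l Hl.
  induction p as [|i p IH]; intros l Hl; destruct (l []) as [[f|x|]|] eqn:E.
  - rewrite (bind_root (subst_fn_root tau E) (Hk f)). now rewrite (subst_fn_root _ E).
  - now rewrite !(subst_var _ E).
  - destruct (Hl _ E).
  - rewrite bind_none, subst_none; auto using subst_none.
  - change (sub (bind k (subst l tau)) i p = sub (subst l (fun x => bind k (tau x))) i p).
    rewrite (bind_sub i (subst_fn_root tau E) (Hk f)), !(subst_fn_sub _ i E).
    apply IH; now apply total_sub.
  - now rewrite !(subst_var _ E).
  - destruct (Hl _ E).
  - rewrite bind_none, subst_none; auto using subst_none.
Qed.

Lemma subst_id (t : term) : wf t -> subst t var = t.
Proof.
  intros Ht; apply term_ext; intros p; revert t Ht.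
  induction p as [|i p IH]; intros t Ht; destruct (wf_root Ht) as [a Ha];
    destruct a as [f|x|].
  - now rewrite (subst_fn_root _ Ha).
  - now rewrite (subst_var _ Ha).
  - rewrite subst_bind, (bind_root (a := Bot F)); auto.
  - change (sub (subst t var) i p = sub t i p). rewrite (subst_fn_sub _ i Ha).
    destruct (le_lt_dec (ar f) i) as [Hi|Hi].
    + assert (Hn : sub t i [] = None) by exact (wf_out [] Ht Ha Hi).
      rewrite subst_none by assumption. symmetry; exact (wf_out p Ht Ha Hi).
    + apply IH; exact (wf_child Ht Ha Hi).
  - rewrite (subst_var _ Ha). symmetry. cbn. apply (wf_out p Ht Ha); cbn; lia.
  - rewrite (root_bot Ht Ha). change (sub (subst bot var) i p = None).
    rewrite subst_bind, (bind_sub (a := Bot F)) by reflexivity. now apply bind_none.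
Qed.

Lemma subst_bot sigma : subst bot sigma = bot.
Proof.
  apply root_bot.
  - apply wf_intro with (a := Bot F); [reflexivity|cbn; intros; lia|].
    intros i p _. change (sub (subst bot sigma) i p = None).
    rewrite subst_bind, (bind_sub (a := Bot F)) by reflexivity. now apply bind_none.
  - reflexivity.
Qed.

(** * Replacement and the prefix order *)

Lemma replace_nil (t u : term) : t [] <> None -> replace t [] u = u.
Proof.
  intros Ht; apply term_ext; intros p; unfold replace.
  destruct (t []) as [a|] eqn:E; [|congruence].
  destruct p; cbn; rewrite E; reflexivity.
Qed.

Lemma replace_root (t u : term) i p : replace t (i :: p) u [] = t [].
Proof. unfold replace; cbn. destruct (t []); reflexivity. Qed.

Lemma replace_sub_eq (t u : term) i p : t [] <> None ->
  sub (replace t (i :: p) u) i = replace (sub t i) p u.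
Proof.
  intros Ht; destruct (t []) as [a|] eqn:E; [|congruence].
  apply term_ext; intros q. unfold sub at 1; unfold replace.
  rewrite graft_cons with (a := a) by auto. f_equal.
  apply functional_extensionality; intros q'; apply functional_extensionality; intros _.
  destruct (list_eq_dec Nat.eq_dec (i :: q') (i :: p)), (list_eq_dec Nat.eq_dec q' p);
    congruence.
Qed.

Lemma replace_sub_neq (t u : term) i j p : wf t -> j <> i ->
  sub (replace t (i :: p) u) j = sub t j.
Proof.
  intros Ht Hj; destruct (wf_root Ht) as [a Ha].
  apply term_ext; intros q. unfold sub at 1; unfold replace.
  rewrite graft_cons with (a := a) by auto.
  match goal with |- graft _ ?h _ _ = _ => replace h with (fun (_ : pos) (_ : sym) => @None term) end.
  2:{ repeat (apply functional_extensionality; intro).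
      destruct (list_eq_dec _ _ _); congruence. }
  destruct (le_lt_dec (arity a) j) as [Hl|Hl].
  - assert (Hn : sub t j [] = None) by exact (wf_out [] Ht Ha Hl).
    transitivity (@None sym); [destruct q; cbn; now rewrite Hn|].
    symmetry; exact (wf_out q Ht Ha Hl).
  - apply graft_id. exact (wf_child Ht Ha Hl).
Qed.

Lemma wf_replace (t u : term) p : wf t -> wf u -> t p <> None -> wf (replace t p u).
Proof.
  revert t; induction p as [|i p IH]; intros t Ht Hu Hp.
  - rewrite replace_nil; assumption.
  - destruct (wf_root Ht) as [a Ha].
    destruct (le_lt_dec (arity a) i) as [Hi|Hi].
    { rewrite (wf_out p Ht Ha Hi) in Hp; congruence. }
    apply wf_intro with (a := a).
    + now rewrite replace_root.
    + intros j Hj. destruct (Nat.eq_dec j i) as [->|Hne].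
      * rewrite replace_sub_eq by congruence. apply IH; auto. eapply wf_child; eauto.
      * rewrite replace_sub_neq by assumption. eapply wf_child; eauto.
    + intros j q Hj. change (sub (replace t (i :: p) u) j q = None).
      rewrite replace_sub_neq; [exact (wf_out q Ht Ha Hj)|assumption|intros ->; lia].
Qed.

Lemma replace_at (t u : term) p : wf t -> t p <> None -> subterm (replace t p u) p = u.
Proof.
  revert t; induction p as [|i p IH]; intros t Ht Hp.
  - now apply replace_nil.
  - destruct (wf_root Ht) as [a Ha].
    destruct (le_lt_dec (arity a) i) as [Hi|Hi].
    { rewrite (wf_out p Ht Ha Hi) in Hp; congruence. }
    rewrite subterm_cons, replace_sub_eq by congruence.
    apply IH; [eapply wf_child; eauto|assumption].
Qed.

Definition prefix (p q : pos) : Prop := exists r, q = p ++ r.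

Lemma prefix_nil q : prefix [] q.
Proof. now exists q. Qed.

Lemma prefix_refl q : prefix q q.
Proof. exists []; now rewrite app_nil_r. Qed.

Lemma prefix_cons i p q : prefix p q -> prefix (i :: p) (i :: q).
Proof. intros [r ->]; now exists r. Qed.

Lemma prefix_trans p q r : prefix p q -> prefix q r -> prefix p r.
Proof. intros [a ->] [b ->]; exists (a ++ b); now rewrite app_assoc. Qed.

Lemma prefix_length p q : prefix p q -> length p <= length q.
Proof. intros [r ->]; rewrite length_app; lia. Qed.

Lemma prefix_comparable p q r : prefix p r -> prefix q r -> prefix p q \/ prefix q p.
Proof.
  revert q r; induction p as [|i p IH]; intros q r Hp Hq; [left; apply prefix_nil|].
  destruct q as [|j q]; [right; apply prefix_nil|].
  destruct Hp as [a ->], Hq as [b Hb]; cbn in Hb; injection Hb as -> Hb.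
  destruct (IH q (p ++ a)) as [H|H]; [now exists a|now exists b|left|right];
    now apply prefix_cons.
Qed.

Lemma replace_other (t u : term) p q : wf t -> ~ prefix p q -> replace t p u q = t q.
Proof.
  revert t q; induction p as [|i p IH]; intros t q Ht Hq.
  - destruct Hq; apply prefix_nil.
  - destruct q as [|j q]; [apply replace_root|].
    destruct (wf_root Ht) as [a Ha].
    change (sub (replace t (i :: p) u) j q = sub t j q).
    destruct (Nat.eq_dec j i) as [->|Hne].
    + rewrite replace_sub_eq by congruence.
      destruct (le_lt_dec (arity a) i) as [Hi|Hi].
      * assert (Hn : sub t i [] = None) by exact (wf_out [] Ht Ha Hi).
        transitivity (@None sym); [|symmetry; exact (wf_out q Ht Ha Hi)].
        unfold replace; destruct q; cbn; now rewrite Hn.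
      * apply IH; [eapply wf_child; eauto|].
        intros H; apply Hq; now apply prefix_cons.
    + now rewrite replace_sub_neq.
Qed.

(** * Rewrite steps *)

Definition rootstep (S : trs F) (t t' : term) : Prop :=
  exists l r sigma, S (l, r) /\ wf_subst ar sigma /\ t = subst l sigma /\ t' = subst r sigma.

Notation step := (@step F ar).
Notation rtc S := (clos_refl_trans term (step1 ar S)).

Lemma step_nil S t t' : wf t -> step S t [] t' <-> rootstep S t t'.
Proof.
  intros Ht; split.
  - intros (l & r & sg & HS & Hw & H0 & Hm & ->). rewrite replace_nil by assumption.
    exists l, r, sg; auto.
  - intros (l & r & sg & HS & Hw & Hm & ->). exists l, r, sg.
    rewrite replace_nil by (exact (proj1 Ht)). pose proof (proj1 Ht); auto 10.
Qed.

Lemma step_cons_inv S t i p t' : wf t -> step S t (i :: p) t' ->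
  exists a, t [] = Some a /\ i < arity a /\ t' [] = Some a /\
    step S (sub t i) p (sub t' i) /\ forall j, j <> i -> sub t' j = sub t j.
Proof.
  intros Ht (l & r & sg & HS & Hw & H0 & Hm & ->).
  destruct (wf_root Ht) as [a Ha]; exists a.
  destruct (le_lt_dec (arity a) i) as [Hi|Hi].
  { destruct H0; exact (wf_out p Ht Ha Hi). }
  splits; try assumption.
  - now rewrite replace_root.
  - exists l, r, sg; do 4 (split; [assumption|]).
    apply replace_sub_eq; congruence.
  - intros j Hj; now apply replace_sub_neq.
Qed.

Lemma step_cons S t i p t' a : wf t -> t [] = Some a -> t' [] = Some a ->
  step S (sub t i) p (sub t' i) -> (forall j, j <> i -> sub t' j = sub t j) ->
  step S t (i :: p) t'.
Proof.
  intros Ht Ha Ha' (l & r & sg & HS & Hw & H0 & Hm & Hr) Hj.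
  exists l, r, sg; do 4 (split; [assumption|]).
  apply term_ext; intros [|j q].
  - rewrite replace_root; congruence.
  - change (sub t' j q = sub (replace t (i :: p) (subst r sg)) j q).
    destruct (Nat.eq_dec j i) as [->|Hne].
    + rewrite replace_sub_eq by congruence. now rewrite Hr.
    + rewrite replace_sub_neq, Hj by assumption. reflexivity.
Qed.

Definition wf_trs (S : trs F) : Prop := forall l r, S (l, r) -> wf l /\ wf r.

Lemma step_wf S t p t' : wf_trs S -> wf t -> step S t p t' -> wf t'.
Proof.
  intros HS Ht (l & r & sg & Hlr & Hw & H0 & Hm & ->).
  apply wf_replace; try assumption. apply wf_subst_term; [assumption|].
  exact (proj2 (HS _ _ Hlr)).
Qed.

Lemma rootstep_wf S t t' : wf_trs S -> wf t -> rootstep S t t' -> wf t'.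
Proof. intros HS Ht H; apply (step_wf HS Ht (proj2 (step_nil S t' Ht) H)). Qed.

Lemma step_mono (S S' : trs F) t p t' : (forall r, S r -> S' r) -> step S t p t' -> step S' t p t'.
Proof.
  intros H (l & r & sg & Hlr & Hrest). exists l, r, sg. split; [now apply H|assumption].
Qed.

Lemma step_inside S t p q t' : wf t -> step S t (p ++ q) t' ->
  step S (subterm t p) q (subterm t' p).
Proof.
  revert t t'; induction p as [|i p IH]; intros t t' Ht Hs; [exact Hs|].
  destruct (step_cons_inv Ht Hs) as (a & Ha & Hi & _ & Hs' & _).
  exact (IH (sub t i) (sub t' i) (wf_child Ht Ha Hi) Hs').
Qed.

Lemma step_label S t p q t' : wf t -> step S t p t' -> ~ prefix p q -> t' q = t q.
Proof.
  intros Ht (l & r & sg & _ & _ & _ & _ & ->) Hq. now apply replace_other.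
Qed.

Lemma step_outside S t p q t' : wf t -> step S t p t' ->
  ~ prefix p q -> ~ prefix q p -> subterm t' q = subterm t q.
Proof.
  intros Ht Hs Hpq Hqp. apply term_ext; intros r; unfold subterm.
  apply (step_label Ht Hs). intros H.
  destruct (prefix_comparable H (q := q)); [exists r; reflexivity|auto..].
Qed.

Lemma rtc_ind_left S (P : term -> Prop) t' :
  P t' -> (forall t u, step1 ar S t u -> rtc S u t' -> P u -> P t) ->
  forall t, rtc S t t' -> P t.
Proof.
  intros H0 H1 t Ht. apply clos_rt_rt1n in Ht.
  induction Ht as [|x y z Hxy Hyz IH]; [assumption|].
  apply (H1 x y); auto. now apply clos_rt1n_rt.
Qed.

Lemma rtc_step S t u t' : step1 ar S t u -> rtc S u t' -> rtc S t t'.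
Proof. intros H1 H2; eapply rt_trans; [apply rt_step|]; eassumption. Qed.

Lemma rtc_root S t u : wf t -> rootstep S t u -> rtc S t u.
Proof. intros Ht H; apply rt_step; exists []; now apply step_nil. Qed.

Lemma rtc_wf S t t' : wf_trs S -> wf t -> rtc S t t' -> wf t'.
Proof.
  intros HS Ht H; induction H as [x y [p Hp]| |]; auto. exact (step_wf HS Ht Hp).
Qed.

Lemma rtc_mono (S S' : trs F) t t' : (forall r, S r -> S' r) -> rtc S t t' -> rtc S' t t'.
Proof.
  intros H Ht; induction Ht as [x y [p Hp]| |]; [|apply rt_refl|eapply rt_trans; eauto].
  apply rt_step; exists p; exact (step_mono H Hp).
Qed.

(** A finite reduction with its contracted positions and an invariant of every term visited, both
    ends included. [rtc] forgets these data, on which the realisation in omega steps depends. *)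
Inductive path (S : trs F) (Q : term -> Prop) : term -> list (pos * term) -> term -> Prop :=
| path_nil s : Q s -> path S Q s [] s
| path_cons s p s1 L s' : Q s -> step S s p s1 -> path S Q s1 L s' ->
    path S Q s ((p, s1) :: L) s'.

Lemma path_start S Q s L s' : path S Q s L s' -> Q s.
Proof. destruct 1; assumption. Qed.

Lemma path_end S Q s L s' : path S Q s L s' -> Q s'.
Proof. induction 1; assumption. Qed.

Lemma path_app S Q s L u L' s' : path S Q s L u -> path S Q u L' s' -> path S Q s (L ++ L') s'.
Proof. induction 1; cbn; [auto|]. intros H'; econstructor; eauto. Qed.

Lemma path_impl S (Q Q' : term -> Prop) s L s' :
  (forall t, Q t -> Q' t) -> path S Q s L s' -> path S Q' s L s'.
Proof. intros H; induction 1; econstructor; eauto. Qed.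

Lemma path_rtc S Q s L s' : path S Q s L s' -> rtc S s s'.
Proof. induction 1; [apply rt_refl|]. eapply rtc_step; [eexists|]; eassumption. Qed.

Lemma rtc_path S (Q : term -> Prop) s s' : rtc S s s' ->
  (forall v, rtc S s v -> rtc S v s' -> Q v) -> exists L, path S Q s L s'.
Proof.
  intros H. pattern s; revert s H; apply rtc_ind_left.
  - intros HQ; exists []; constructor; apply HQ; apply rt_refl.
  - intros t u [p Hp] Hu IH HQ. destruct IH as [L HL].
    { intros v Hv Hv'. apply HQ; [|assumption]. eapply rtc_step; [exists p|]; eassumption. }
    exists ((p, u) :: L). econstructor; eauto. apply HQ; [apply rt_refl|].
    eapply rtc_step; [exists p|]; eassumption.
Qed.

Definition update (a : sym) (t : term) (k : nat) (u : term) : term :=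
  node a (fun j => if Nat.eq_dec j k then u else sub t j).

Lemma update_sub_eq a t k u : k < arity a -> sub (update a t k u) k = u.
Proof. intros H; unfold update; rewrite node_sub by assumption. now destruct (Nat.eq_dec k k). Qed.

Lemma update_sub_neq a t k u j : wf t -> t [] = Some a -> j <> k ->
  sub (update a t k u) j = sub t j.
Proof.
  intros Ht Ha Hj. apply term_ext; intros p; unfold sub, update; cbn.
  destruct (lt_dec j (arity a)); [now destruct (Nat.eq_dec j k)|].
  symmetry; apply (wf_out p Ht Ha); lia.
Qed.

Lemma wf_update a t k u : wf t -> t [] = Some a -> wf u -> wf (update a t k u).
Proof.
  intros Ht Ha Hu; apply wf_node; intros i Hi. destruct (Nat.eq_dec i k); [assumption|].
  eapply wf_child; eauto.
Qed.

Lemma step_update S a t k p u : wf t -> t [] = Some a -> k < arity a ->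
  step S (sub t k) p u -> step S t (k :: p) (update a t k u).
Proof.
  intros Ht Ha Hk Hs. eapply step_cons; eauto.
  - now rewrite update_sub_eq.
  - intros j Hj; now apply update_sub_neq.
Qed.

Lemma path_child S Q a s k L u : wf_trs S -> wf s -> s [] = Some a -> k < arity a ->
  path S Q (sub s k) L u ->
  exists L', path S (fun v => wf v /\ v [] = Some a /\ Q (sub v k) /\
                              forall j, j <> k -> sub v j = sub s j) s L' (update a s k u) /\
    map fst L' = map (cons k) (map fst L).
Proof.
  intros HS Hs Ha Hk H. remember (sub s k) as s0 eqn:E. revert s Hs Ha E.
  induction H as [s0 H0|s0 p s1 L s' H0 Hst Hp IH]; intros s Hs Ha ->.
  - exists []; split; [|reflexivity].
    replace (update a s k (sub s k)) with s.
    + constructor; auto.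
    + rewrite <- (node_eta Hs Ha) at 1. apply node_ext; intros i Hi.
      now destruct (Nat.eq_dec i k) as [->|].
  - assert (Hw1 : wf s1) by (refine (step_wf HS _ Hst); eapply wf_child; eauto).
    destruct (IH (update a s k s1)) as (L' & HL & Hm).
    + now apply wf_update.
    + reflexivity.
    + now rewrite update_sub_eq.
    + exists ((k :: p, update a s k s1) :: L'); split.
      * econstructor; [splits; auto|now apply step_update|].
        replace (update a s k s') with (update a (update a s k s1) k s').
        -- eapply path_impl; [|exact HL]. intros v (H1 & H2 & H3 & H4); splits; auto.
           intros j Hj; rewrite H4 by assumption. now apply update_sub_neq.
        -- apply node_ext; intros i Hi; destruct (Nat.eq_dec i k); [reflexivity|].
           now apply update_sub_neq.
      * cbn; now rewrite Hm.
Qed.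

(** There are finitely many children, so their reductions can be run one after another. A child that
    is not being reduced sits at one end of its own path, where its invariant holds as well. *)
Lemma path_children S (Q : nat -> term -> Prop) a s (L : nat -> list (pos * term)) w :
  wf_trs S -> wf s -> s [] = Some a ->
  (forall i, i < arity a -> path S (Q i) (sub s i) (L i) (w i)) ->
  exists L', path S (fun v => wf v /\ v [] = Some a /\ forall i, i < arity a -> Q i (sub v i))
               s L' (node a w) /\
    (forall p, In p (map fst L') <->
       exists i p', i < arity a /\ p = i :: p' /\ In p' (map fst (L i))).
Proof.
  intros HS Hs Ha H.
  assert (Hk : forall k, k <= arity a ->
    exists L', path S (fun v => wf v /\ v [] = Some a /\ forall i, i < arity a -> Q i (sub v i))
               s L' (node a (fun i => if lt_dec i k then w i else sub s i)) /\
    (forall p, In p (map fst L') <->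
       exists i p', i < k /\ p = i :: p' /\ In p' (map fst (L i)))).
  { induction k as [|k IH]; intros Hk.
    - exists []; split.
      + replace (node a _) with s.
        * constructor; splits; auto. intros i Hi; exact (path_start (H i Hi)).
        * rewrite <- (node_eta Hs Ha) at 1. apply node_ext; reflexivity.
      + intros p; cbn; split; [tauto|]. intros (i & p' & Hi & _); lia.
    - destruct IH as (L1 & HL1 & Hin); [lia|].
      set (v := node a (fun i => if lt_dec i k then w i else sub s i)) in *.
      destruct (path_end HL1) as (Hv & Hva & HvQ).
      assert (Hvk : sub v k = sub s k).
      { unfold v; rewrite node_sub by lia. destruct (lt_dec k k); [lia|reflexivity]. }
      destruct (path_child (s := v) (k := k) (a := a) HS Hv Hva Hk (Q := Q k) (L := L k) (u := w k))
        as (L2 & HL2 & Hm).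
      { rewrite Hvk; apply H; lia. }
      exists (L1 ++ L2); split.
      + eapply path_app; [exact HL1|].
        replace (node a _) with (update a v k (w k)).
        * eapply path_impl; [|exact HL2]. intros t (Ht & Hta & Htk & Hto).
          splits; auto. intros i Hi. destruct (Nat.eq_dec i k) as [->|Hne]; [assumption|].
          rewrite Hto by assumption. auto.
        * apply node_ext; intros i Hi. destruct (Nat.eq_dec i k) as [->|Hne].
          -- destruct (lt_dec k (Datatypes.S k)); [reflexivity|lia].
          -- unfold v; rewrite node_sub by assumption.
             destruct (lt_dec i k), (lt_dec i (Datatypes.S k)); try reflexivity; lia.
      + intros p. rewrite map_app, in_app_iff, Hin, Hm, in_map_iff. split.
        * intros [(i & p' & Hi & -> & Hp)|(p' & <- & Hp)].
          -- exists i, p'; splits; auto.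
          -- exists k, p'; splits; auto.
        * intros (i & p' & Hi & -> & Hp). destruct (Nat.eq_dec i k) as [->|Hne].
          -- right; eauto.
          -- left; exists i, p'; splits; auto; lia. }
  destruct (Hk (arity a) (le_n _)) as (L' & HL & Hin). exists L'; split; [|assumption].
  replace (node a w) with (node a (fun i => if lt_dec i (arity a) then w i else sub s i));
    [assumption|].
  apply node_ext; intros i Hi. destruct (lt_dec i (arity a)); [reflexivity|lia].
Qed.

Lemma rtc_children S a s w : wf_trs S -> wf s -> s [] = Some a ->
  (forall i, i < arity a -> rtc S (sub s i) (w i)) -> rtc S s (node a w).
Proof.
  intros HS Hs Ha H.
  assert (HL : forall i, exists L, i < arity a -> path S (fun _ => True) (sub s i) L (w i)).
  { intros i; destruct (lt_dec i (arity a)) as [Hi|Hi]; [|now exists []].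
    destruct (rtc_path (Q := fun _ => True) (H i Hi)) as [L HL]; [auto|]. now exists L. }
  apply ClassicalEpsilon.choice in HL as [L HL].
  destruct (path_children (Q := fun _ _ => True) (L := L) (w := w) HS Hs Ha HL) as (L' & HL' & _).
  exact (path_rtc HL').
Qed.

(** * Coinductive reductions *)

(** Only function symbols are compared; for a linear pattern this already makes [t] an instance
    ([matches_subst]). *)
Definition matches (l t : term) : Prop := forall p f, l p = Some (Fn f) -> t p = Some (Fn f).

Definition linear (l : term) : Prop :=
  forall p q x, l p = Some (Vr F x) -> l q = Some (Vr F x) -> p = q.

Lemma matches_sub l t i : matches l t -> matches (sub l i) (sub t i).
Proof. intros H p f; exact (H (i :: p) f). Qed.

Lemma parent_fn (l : term) p i q : wf l -> total l -> l (p ++ i :: q) <> None ->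
  exists f, l p = Some (Fn f) /\ i < ar f.
Proof.
  intros Hl Ht Hp.
  assert (Hp0 : l p <> None) by (eapply wf_prefix; eauto).
  destruct (l p) as [a|] eqn:E; [|congruence].
  assert (Hi : i < arity a).
  { destruct (le_lt_dec (arity a) i) as [Hi|Hi]; [exfalso|assumption].
    assert (Hw : wf (subterm l p)) by (apply wf_subterm; congruence).
    apply Hp. refine (wf_out (t := subterm l p) q Hw _ Hi).
    unfold subterm; now rewrite app_nil_r. }
  destruct a as [f|x|]; cbn in Hi; try lia. eauto.
Qed.

Lemma matches_defined l t p : wf l -> total l -> wf t -> matches l t -> l p <> None -> t p <> None.
Proof.
  revert l t; induction p as [|i p IH]; intros l t Hl Htl Ht Hm Hp; [exact (proj1 Ht)|].
  destruct (parent_fn (p := []) Hl Htl Hp) as (f & Hf & Hi).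
  apply (IH (sub l i) (sub t i)); auto using total_sub, matches_sub.
  - exact (wf_child Hl Hf Hi).
  - exact (wf_child Ht (Hm _ _ Hf) Hi).
Qed.

Lemma subst_matches l sigma : wf l -> total l -> matches l (subst l sigma).
Proof.
  intros Hl Ht p f Hp.
  assert (H : subterm (subst l sigma) p [] = Some (Fn f)).
  { rewrite subst_at by (congruence || assumption). apply subst_fn_root.
    unfold subterm; now rewrite app_nil_r. }
  unfold subterm in H; now rewrite app_nil_r in H.
Qed.

Lemma subst_at_var l sigma p x : wf l -> total l -> l p = Some (Vr F x) ->
  subterm (subst l sigma) p = sigma x.
Proof.
  intros Hl Ht Hp. rewrite subst_at by (congruence || assumption).
  apply subst_var. unfold subterm; now rewrite app_nil_r.
Qed.

Lemma matches_subst_aux l t sigma : wf l -> total l -> wf t -> matches l t ->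
  (forall p x, l p = Some (Vr F x) -> sigma x = subterm t p) -> t = subst l sigma.
Proof.
  intros Hl Htl Ht Hm Hs; apply term_ext; intros p; revert l t Hl Htl Ht Hm Hs.
  induction p as [|i p IH]; intros l t Hl Htl Ht Hm Hs; destruct (wf_root Hl) as [[f|x|] Ha].
  - now rewrite (subst_fn_root _ Ha), (Hm _ _ Ha).
  - now rewrite (subst_var _ Ha), (Hs _ _ Ha).
  - destruct (Htl _ Ha).
  - change (sub t i p = sub (subst l sigma) i p). rewrite (subst_fn_sub _ i Ha).
    destruct (le_lt_dec (ar f) i) as [Hi|Hi].
    + rewrite subst_none by exact (wf_out [] Hl Ha Hi).
      exact (wf_out p Ht (Hm _ _ Ha) Hi).
    + apply IH; auto using total_sub, matches_sub.
      * exact (wf_child Hl Ha Hi).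
      * exact (wf_child Ht (Hm _ _ Ha) Hi).
      * intros q x Hq. exact (Hs (i :: q) x Hq).
  - now rewrite (subst_var _ Ha), (Hs _ _ Ha).
  - destruct (Htl _ Ha).
Qed.

Lemma matches_subst l t : wf l -> total l -> linear l -> wf t -> matches l t ->
  exists sigma, wf_subst ar sigma /\ t = subst l sigma /\
    forall p x, l p = Some (Vr F x) -> sigma x = subterm t p.
Proof.
  intros Hl Htl Hlin Ht Hm.
  assert (Hs : forall x, exists u, wf u /\ forall p, l p = Some (Vr F x) -> u = subterm t p).
  { intros x. destruct (classic (exists p, l p = Some (Vr F x))) as [[p Hp]|Hn].
    - exists (subterm t p); split.
      + apply wf_subterm; [assumption|]. refine (matches_defined Hl Htl Ht Hm _); congruence.
      + intros q Hq. now rewrite (Hlin p q x).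
    (* A variable that does not occur in [l] gets an arbitrary well-formed value. *)
    - exists bot; split; [apply wf_bot|]. intros p Hp; destruct Hn; eauto. }
  apply ClassicalEpsilon.choice in Hs as [sigma Hs]. exists sigma.
  assert (Hv : forall p x, l p = Some (Vr F x) -> sigma x = subterm t p)
    by (intros p x; apply Hs).
  splits; [intros x; apply Hs|now apply matches_subst_aux|assumption].
Qed.

(** * Greatest fixed points *)

Definition gfp (Phi : (term -> term -> Prop) -> term -> term -> Prop) (s t : term) : Prop :=
  exists X : term -> term -> Prop, (forall u v, X u v -> Phi X u v) /\ X s t.

Definition monotone (Phi : (term -> term -> Prop) -> term -> term -> Prop) : Prop :=
  forall (X Y : term -> term -> Prop), (forall u v, X u v -> Y u v) ->
    forall u v, Phi X u v -> Phi Y u v.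

Lemma gfp_unfold Phi s t : monotone Phi -> gfp Phi s t -> Phi (gfp Phi) s t.
Proof.
  intros HM (X & HX & Hst). apply (HM X); [|auto]. intros u v Huv; now exists X.
Qed.

(** Coinduction up to the fixed point: a pair may leave the invariant as soon as it is known to be
    in [gfp], at once or after one unfolding. *)
Lemma gfp_coind Phi (X : term -> term -> Prop) : monotone Phi ->
  (forall u v, X u v -> gfp Phi u v \/ Phi (fun a b => X a b \/ gfp Phi a b) u v) ->
  forall s t, X s t -> gfp Phi s t.
Proof.
  intros HM HX s t Hst. exists (fun a b => X a b \/ gfp Phi a b); split; [|auto].
  assert (H : forall u v, gfp Phi u v -> Phi (fun a b => X a b \/ gfp Phi a b) u v).
  { intros u v Huv. apply (HM (gfp Phi)); [auto|]. now apply gfp_unfold. }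
  intros u v [Huv|Huv]; [|auto]. destruct (HX _ _ Huv); auto.
Qed.

Lemma gfp_fold Phi s t : monotone Phi -> Phi (gfp Phi) s t -> gfp Phi s t.
Proof.
  intros HM H. apply (gfp_coind (X := Phi (gfp Phi)) HM); [|assumption].
  intros u v Huv; right. revert Huv; apply HM; auto.
Qed.

Definition same_node (X : term -> term -> Prop) (s t : term) : Prop :=
  s [] = t [] /\ forall a i, t [] = Some a -> i < arity a -> X (sub s i) (sub t i).

(** Since [Phi] contains [same_node], the coinduction runs through the possibly infinitely many
    symbols of [r] down to its variables. *)
Lemma gfp_subst Phi r sigma tau : monotone Phi ->
  (forall (X : term -> term -> Prop) s t, same_node X s t -> Phi X s t) ->
  wf r -> total r ->
  (forall p x, r p = Some (Vr F x) -> gfp Phi (sigma x) (tau x)) ->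
  gfp Phi (subst r sigma) (subst r tau).
Proof.
  intros HM HN Hr Ht Hv.
  apply (gfp_coind (X := fun s t => exists r, wf r /\ total r /\
     (forall p x, r p = Some (Vr F x) -> gfp Phi (sigma x) (tau x)) /\
     s = subst r sigma /\ t = subst r tau) HM); [|exists r; auto].
  clear r Hr Ht Hv; intros u v (r & Hr & Ht & Hv & -> & ->).
  destruct (wf_root Hr) as [[f|x|] Ha].
  - right; apply HN. split; [now rewrite !(subst_fn_root _ Ha)|].
    rewrite (subst_fn_root _ Ha). intros a i [= <-] Hi. left.
    rewrite !(subst_fn_sub _ i Ha). exists (sub r i); splits; auto using total_sub.
    + exact (wf_child Hr Ha Hi).
    + intros p x Hp; exact (Hv (i :: p) x Hp).
  - left. rewrite !(subst_var _ Ha). exact (Hv _ _ Ha).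
  - destruct (Ht _ Ha).
Qed.

(* Coinductive presentation of convergent reductions in [S]: reduce finitely until the root
   is final, then continue with the children; [P] holds of the terms that may collapse to
   bottom. *)
Definition infredF (S : trs F) (P : term -> Prop) (X : term -> term -> Prop) (s t : term) : Prop :=
  (t = bot /\ P s) \/ exists s', rtc S s s' /\ same_node X s' t.

Definition infred S P : term -> term -> Prop := gfp (infredF S P).

Lemma infredF_mono S P : monotone (infredF S P).
Proof.
  intros X Y H u v [Hb|(s' & Hs & H0 & Hc)]; [now left|right].
  exists s'; splits; auto. split; [assumption|]. eauto.
Qed.

Lemma infred_refl S P t : infred S P t t.
Proof.
  apply (gfp_coind (X := eq) (@infredF_mono S P)); [|reflexivity].
  intros u ? <-; right; right. exists u; split; [apply rt_refl|split; auto].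
Qed.

Lemma infred_unfold S P s t : infred S P s t -> infredF S P (infred S P) s t.
Proof. exact (gfp_unfold (@infredF_mono S P)). Qed.

Lemma infred_fold S P s t : infredF S P (infred S P) s t -> infred S P s t.
Proof. exact (gfp_fold (@infredF_mono S P)). Qed.

Lemma infred_rtc S (P : term -> Prop) s u t : (forall s u, rtc S s u -> P u -> P s) ->
  rtc S s u -> infred S P u t -> infred S P s t.
Proof.
  intros HP H Hu; apply infred_fold.
  destruct (infred_unfold Hu) as [[H1 H2]|(s' & Hs & Hn)]; [left; eauto|right].
  exists s'; split; [|assumption]. eapply rt_trans; eauto.
Qed.

Lemma infred_subst S P r sigma tau : wf r -> total r ->
  (forall p x, r p = Some (Vr F x) -> infred S P (sigma x) (tau x)) ->
  infred S P (subst r sigma) (subst r tau).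
Proof.
  intros Hr Ht Hv. apply gfp_subst; auto; [apply infredF_mono|].
  intros X s t Hst; right; exists s; split; [apply rt_refl|assumption].
Qed.

(* Possibly infinite development in which [B] may be used at disjoint positions. *)
Definition liftF (B : term -> term -> Prop) (X : term -> term -> Prop) (s t : term) : Prop :=
  B s t \/ same_node X s t.

Definition lift B : term -> term -> Prop := gfp (liftF B).

Lemma liftF_mono B : monotone (liftF B).
Proof. intros X Y H u v [Hb|[H0 Hc]]; [now left|right]. split; [assumption|]; eauto. Qed.

Lemma lift_unfold B s t : lift B s t -> B s t \/ same_node (lift B) s t.
Proof. exact (gfp_unfold (@liftF_mono B)). Qed.

Lemma lift_fold B s t : B s t \/ same_node (lift B) s t -> lift B s t.
Proof. exact (gfp_fold (@liftF_mono B)). Qed.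

Lemma lift_refl B t : lift B t t.
Proof.
  apply (gfp_coind (X := eq) (@liftF_mono B)); [|reflexivity].
  intros u ? <-; right; right; split; auto.
Qed.

Lemma lift_subst B r sigma tau : wf r -> total r ->
  (forall p x, r p = Some (Vr F x) -> lift B (sigma x) (tau x)) ->
  lift B (subst r sigma) (subst r tau).
Proof.
  intros Hr Ht Hv. apply gfp_subst; auto; [apply liftF_mono|]. intros; now right.
Qed.

(** * Consequences of orthogonality *)

Variable R : trs F.
Hypothesis HR : is_trs ar R.
Hypothesis Hlin : left_linear R.
Hypothesis Hno : non_overlapping ar R.
Hypothesis Hfin : left_finite R.

Lemma wf_R : wf_trs R.
Proof. intros l r H; destruct (HR H) as (? & ? & _); auto. Qed.

Lemma lhs_root l r : R (l, r) -> exists f, l [] = Some (Fn f).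
Proof.
  intros H; destruct (HR H) as (Hl & _ & Ht & _ & Hv & _).
  destruct (wf_root Hl) as [[f|x|] Ha]; [eauto|destruct (Hv _ Ha)|destruct (Ht _ Ha)].
Qed.

Lemma lhs_sub_matches l r q t : R (l, r) -> l q <> None -> wf t -> matches (subterm l q) t ->
  exists sigma, wf_subst ar sigma /\ t = subst (subterm l q) sigma /\
    forall p x, l (q ++ p) = Some (Vr F x) -> sigma x = subterm t p.
Proof.
  intros H Hq Ht Hm; destruct (HR H) as (Hl & _ & Htl & _).
  apply matches_subst; auto.
  - now apply wf_subterm.
  - intros p; exact (Htl (q ++ p)).
  - intros p p' x Hp Hp'. apply (app_inv_head q). exact (Hlin H Hp Hp').
Qed.

(** By left-linearity [s] is an instance of the subpattern; a redex at its root would overlap with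
    [l] below the root of [l]. *)
Lemma no_overlap l r q f s t : R (l, r) -> q <> [] -> l q = Some (Fn f) -> wf s ->
  matches (subterm l q) s -> ~ rootstep R s t.
Proof.
  intros H Hq Hf Hs Hm (l1 & r1 & s1 & H1 & Hw1 & Hs1 & _).
  destruct (lhs_sub_matches (l := l) (r := r) (q := q) (t := s)) as (s2 & Hw2 & Hs2 & _);
    auto; [congruence|].
  destruct (Hno H1 H Hf) as [Hq' _]; [|contradiction].
  exists s1, s2; splits; auto. now rewrite <- Hs1, <- Hs2.
Qed.

(** Non-overlap at the root identifies the two rules; the substitutions then agree on the variables
    of [l], which include those of [r]. *)
Lemma redex_unique l r sigma s t : R (l, r) -> wf_subst ar sigma -> s = subst l sigma ->
  rootstep R s t -> t = subst r sigma.
Proof.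
  intros H Hw Hs (l1 & r1 & s1 & H1 & Hw1 & Hs1 & ->).
  destruct (lhs_root H) as [f Hf].
  assert (He : (l1, r1) = (l, r)).
  { apply (Hno (pi := []) H1 H Hf). exists s1, sigma; splits; auto.
    rewrite subterm_nil; congruence. }
  injection He as -> ->.
  destruct (HR H) as (Hl & Hr & Htl & Htr & _ & Hv).
  apply matches_subst_aux; try assumption.
  - now apply wf_subst_term.
  - now apply subst_matches.
  - intros p x Hp. destruct (Hv _ _ Hp) as [q Hq].
    rewrite (subst_at_var _ Hr Htr Hp).
    rewrite <- (subst_at_var sigma Hl Htl Hq), <- (subst_at_var s1 Hl Htl Hq). congruence.
Qed.

(** As [B] cannot act at a function symbol of [l], the coinductive derivation has to descend through
    the whole pattern, and [B] is used only from the variables on. It is applied to root steps and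
    to the cutting of root-active subterms. *)
Lemma lift_match B l r : R (l, r) ->
  (forall q f s t, q <> [] -> l q = Some (Fn f) -> wf s -> matches (subterm l q) s -> ~ B s t) ->
  forall p q s t, q <> [] -> wf s -> lift B s t -> matches (subterm l q) s ->
    (forall f, l (q ++ p) = Some (Fn f) -> t p = Some (Fn f)) /\
    (forall x, l (q ++ p) = Some (Vr F x) -> lift B (subterm s p) (subterm t p)).
Proof.
  intros H HB; destruct (HR H) as (Hl & _ & Htl & _).
  assert (Hnode : forall q f s t, q <> [] -> wf s -> lift B s t -> matches (subterm l q) s ->
    l q = Some (Fn f) -> s [] = Some (Fn f) /\ same_node (lift B) s t).
  { intros q f s t Hq Hs Hst Hm Hf. split.
    - apply (Hm []). unfold subterm; now rewrite app_nil_r.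
    - destruct (lift_unfold Hst); [|assumption]. destruct (HB q f s t); auto. }
  induction p as [|i p IH]; intros q s t Hq Hs Hst Hm.
  - rewrite app_nil_r; split; [|auto]. intros f Hf.
    destruct (Hnode q f s t) as (Hsf & He & _); auto. congruence.
  - destruct (classic (l (q ++ i :: p) = None)) as [Hn|Hn].
    { split; intros; congruence. }
    destruct (parent_fn Hl Htl Hn) as (f & Hf & Hi).
    destruct (Hnode q f s t) as (Hsf & He & Hc); auto.
    replace (q ++ i :: p) with ((q ++ [i]) ++ p) by now rewrite <- app_assoc.
    apply (IH (q ++ [i]) (sub s i) (sub t i)).
    + now destruct q.
    + exact (wf_child Hs Hsf Hi).
    + apply (Hc (Fn f)); [congruence|assumption].
    + intros p' g Hp'. apply (Hm (i :: p')). unfold subterm in *.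
      now rewrite <- app_assoc in Hp'.
Qed.

Lemma lift_match_root B l r s t : R (l, r) ->
  (forall q f s t, q <> [] -> l q = Some (Fn f) -> wf s -> matches (subterm l q) s -> ~ B s t) ->
  wf s -> same_node (lift B) s t -> matches l s ->
  matches l t /\
  forall p x, l p = Some (Vr F x) -> lift B (subterm s p) (subterm t p).
Proof.
  intros H HB Hs [He Hc] Hm; destruct (HR H) as (Hl & _ & Htl & _).
  destruct (lhs_root H) as [f Hf]. pose proof (Hm _ _ Hf) as Hsf.
  assert (Hch : forall i p, l (i :: p) <> None ->
    (forall g, l (i :: p) = Some (Fn g) -> t (i :: p) = Some (Fn g)) /\
    (forall x, l (i :: p) = Some (Vr F x) -> lift B (subterm s (i :: p)) (subterm t (i :: p)))).
  { intros i p Hp. destruct (parent_fn (p := []) Hl Htl Hp) as (f' & Hf' & Hi).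
    assert (f' = f) by congruence; subst f'.
    apply (lift_match H HB p (q := [i]) (s := sub s i) (t := sub t i)).
    - congruence.
    - exact (wf_child Hs Hsf Hi).
    - apply (Hc (Fn f)); [congruence|assumption].
    - apply matches_sub; exact Hm. }
  split.
  - intros [|i p] g Hg; [congruence|]. destruct (Hch i p) as [H1 H2]; [congruence|]. exact (H1 _ Hg).
  - intros [|i p] x Hx; [congruence|]. destruct (Hch i p) as [H1 H2]; [congruence|]. exact (H2 _ Hx).
Qed.

(** * Infinitely many root steps *)

(** Existence of one reduction with infinitely many root steps, as a post-fixed point. In contrast,
    [root_active] quantifies over all finite reductions and is restricted to total terms. *)
Definition inf_root (s : term) : Prop :=
  exists X : term -> Prop,
    (forall u, X u -> exists u1 u2, rtc R u u1 /\ rootstep R u1 u2 /\ X u2) /\ X s.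

Lemma inf_root_unfold s : inf_root s ->
  exists u1 u2, rtc R s u1 /\ rootstep R u1 u2 /\ inf_root u2.
Proof.
  intros (X & HX & Hs). destruct (HX s Hs) as (u1 & u2 & H1 & H2 & H3).
  exists u1, u2; splits; auto. now exists X.
Qed.

Lemma inf_root_rtc s u : rtc R s u -> inf_root u -> inf_root s.
Proof.
  intros H Hu. exists (fun v => exists u, rtc R v u /\ inf_root u); split; [|eauto].
  clear; intros v (u & Hv & Hu). destruct (inf_root_unfold Hu) as (u1 & u2 & H1 & H2 & H3).
  exists u1, u2; splits; auto.
  - eapply rt_trans; eauto.
  - exists u2; split; [apply rt_refl|assumption].
Qed.

(** The depth bound on [l] limits the number of unfoldings, so finitely many steps suffice. A
    function symbol of the pattern excludes a collapse on the way. *)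
Lemma infred_match P n : forall l s t, wf l -> total l ->
  (forall p, n <= length p -> l p = None) -> wf s -> wf t -> infred R P s t -> matches l t ->
  exists s', rtc R s s' /\ wf s' /\ matches l s' /\
    forall p x, l p = Some (Vr F x) -> infred R P (subterm s' p) (subterm t p).
Proof.
  induction n as [|n IH]; intros l s t Hl Htl Hn Hs Ht Hst Hm.
  { destruct (proj1 Hl); apply Hn; cbn; lia. }
  destruct (wf_root Hl) as [[f|x|] Ha]; [| |destruct (Htl _ Ha)].
  - pose proof (Hm _ _ Ha) as Hta.
    destruct (infred_unfold Hst) as [[-> _]|(s1 & Hs1 & He & Hc)]; [discriminate|].
    assert (Hw1 : wf s1) by exact (rtc_wf wf_R Hs Hs1).
    assert (H1a : s1 [] = Some (Fn f)) by congruence.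
    assert (Hch : forall i, exists w, i < ar f -> rtc R (sub s1 i) w /\ wf w /\
      matches (sub l i) w /\
      forall p x, l (i :: p) = Some (Vr F x) -> infred R P (subterm w p) (subterm t (i :: p))).
    { intros i. destruct (lt_dec i (ar f)) as [Hi|Hi]; [|exists bot; lia].
      destruct (IH (sub l i) (sub s1 i) (sub t i)) as (w & Hw).
      - exact (wf_child Hl Ha Hi).
      - now apply total_sub.
      - intros p Hp; apply Hn; cbn; lia.
      - exact (wf_child Hw1 H1a Hi).
      - exact (wf_child Ht Hta Hi).
      - exact (Hc (Fn f) i Hta Hi).
      - now apply matches_sub.
      - now exists w. }
    apply ClassicalEpsilon.choice in Hch as [w Hw].
    exists (node (Fn f) w); splits.
    + eapply rt_trans; [exact Hs1|]. apply rtc_children; auto using wf_R.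
      intros i Hi; apply Hw; assumption.
    + apply wf_node; intros i Hi; apply Hw; assumption.
    + intros [|i p] g Hg; [cbn; congruence|].
      destruct (le_lt_dec (ar f) i) as [Hi|Hi].
      { rewrite (wf_out p Hl Ha Hi) in Hg; congruence. }
      destruct (Hw i Hi) as (_ & _ & Hmi & _).
      cbn; destruct (lt_dec i (ar f)); [|lia]. exact (Hmi _ _ Hg).
    + intros [|i p] x Hx; [congruence|].
      destruct (le_lt_dec (ar f) i) as [Hi|Hi].
      { rewrite (wf_out p Hl Ha Hi) in Hx; congruence. }
      destruct (Hw i Hi) as (_ & _ & _ & Hv).
      rewrite subterm_cons, (node_sub w (a := Fn f)) by assumption. exact (Hv _ _ Hx).
  - exists s; splits; [apply rt_refl|assumption| |].
    + intros [|i p] f Hf; [congruence|]. rewrite (wf_out p Hl Ha) in Hf by (cbn; lia). congruence.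
    + intros [|i p] y Hy; [assumption|]. rewrite (wf_out p Hl Ha) in Hy by (cbn; lia). congruence.
Qed.

(** The root step of [t] is answered by a genuine root step after [s]; this is how root steps are
    counted through [infred]. *)
Lemma infred_root P s t t' : wf s -> wf t -> infred R P s t -> rootstep R t t' ->
  exists s1 s2, rtc R s s1 /\ wf s1 /\ rootstep R s1 s2 /\ infred R P s2 t'.
Proof.
  intros Hs Ht Hst (l & r & sg & H & Hw & -> & ->).
  destruct (HR H) as (Hl & Hr & Htl & Htr & _ & Hv). destruct (Hfin H) as [n Hn].
  destruct (infred_match (n := Datatypes.S n) (l := l) (P := P) (s := s) (t := subst l sg))
    as (s' & Hs' & Hw' & Hm & Hvar); auto using subst_matches.
  destruct (matches_subst Hl Htl (Hlin H) Hw' Hm) as (sg' & Hwsg & -> & Hval).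
  exists (subst l sg'), (subst r sg'); splits; auto.
  - exists l, r, sg'; auto.
  - apply infred_subst; auto. intros p x Hx. destruct (Hv _ _ Hx) as [q Hq].
    rewrite <- (subst_at_var sg Hl Htl Hq), (Hval _ _ Hq). exact (Hvar _ _ Hq).
Qed.

(** Stated for any [S] so as to serve [R] and its Böhm extension. A step below the root shows that
    [t] has children, so it is not a collapsed bottom. *)
Lemma infred_step_of_root P S : wf_trs S ->
  (forall s t t', wf s -> wf t -> infred R P s t -> rootstep S t t' -> infred R P s t') ->
  forall p s t t', wf s -> wf t -> infred R P s t -> step S t p t' -> infred R P s t'.
Proof.
  intros HS Hroot; induction p as [|i p IH]; intros s t t' Hs Ht Hst Hstep.
  - apply step_nil in Hstep; eauto.
  - destruct (step_cons_inv Ht Hstep) as (a & Ha & Hi & Ha' & Hstep' & Hj).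
    destruct (infred_unfold Hst) as [[-> _]|(s1 & Hs1 & He & Hc)].
    { injection Ha as <-; cbn in Hi; lia. }
    assert (Hw1 : wf s1) by exact (rtc_wf wf_R Hs Hs1).
    apply infred_fold; right; exists s1; split; [assumption|]. split; [congruence|].
    intros b j Hb Hjb. assert (b = a) by congruence; subst b.
    specialize (Hc a j Ha Hjb). destruct (Nat.eq_dec j i) as [->|Hne].
    + apply (IH _ (sub t i)); auto.
      * refine (wf_child Hw1 _ Hi); congruence.
      * exact (wf_child Ht Ha Hi).
    + rewrite Hj; assumption.
Qed.

Section Infred.
Variable P : term -> Prop.
Hypothesis HP : forall s u, rtc R s u -> P u -> P s.

Lemma infred_step p s t t' : wf s -> wf t -> infred R P s t -> step R t p t' -> infred R P s t'.
Proof.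
  apply infred_step_of_root; [exact wf_R|]. clear p s t t'.
  intros s t t' Hs Ht Hst H. destruct (infred_root Hs Ht Hst H) as (s1 & s2 & H1 & Hw & H2 & H3).
  apply (infred_rtc HP (u := s2)); [|assumption].
  eapply rt_trans; [exact H1|now apply rtc_root].
Qed.

Lemma infred_rtc_r s t t' : wf s -> wf t -> infred R P s t -> rtc R t t' -> infred R P s t'.
Proof.
  intros Hs Ht Hst H. apply clos_rt_rt1n in H. revert Ht Hst.
  induction H as [|t u t' [p Hp] _ IH]; [auto|]. intros Ht Hst.
  apply IH; [exact (step_wf wf_R Ht Hp)|]. eapply infred_step; eauto.
Qed.

Lemma infred_par s t t' : wf s -> wf t -> wf t' -> infred R P s t -> lift (rootstep R) t t' ->
  infred R P s t'.
Proof.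
  intros Hs Ht Ht' Hst Htt.
  apply (gfp_coind (X := fun s t' => exists t, wf s /\ wf t /\ wf t' /\ infred R P s t /\
    lift (rootstep R) t t') (@infredF_mono R P)); [|exists t; auto].
  clear s t t' Hs Ht Ht' Hst Htt. intros s t' (t & Hs & Ht & Ht' & Hst & Htt).
  destruct (lift_unfold Htt) as [Hr|[He Hc]].
  - left. apply (infred_step (p := []) Hs Ht Hst). now apply step_nil.
  - right. destruct (infred_unfold Hst) as [[-> Hp]|(s1 & Hs1 & He1 & Hc1)].
    + left. split; [|assumption]. apply root_bot; auto.
    + right; exists s1; split; [assumption|split; [congruence|]].
      intros a i Ha Hi. left. assert (Hta : t [] = Some a) by congruence.
      pose proof (rtc_wf wf_R Hs Hs1) as Hw1. exists (sub t i); splits.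
      * refine (wf_child Hw1 _ Hi); congruence.
      * exact (wf_child Ht Hta Hi).
      * exact (wf_child Ht' Ha Hi).
      * exact (Hc1 a i Hta Hi).
      * exact (Hc a i Ha Hi).
Qed.
End Infred.

Lemma infred_inf_root P s t : (forall s u, rtc R s u -> P u -> P s) ->
  wf s -> wf t -> infred R P s t -> inf_root t -> inf_root s.
Proof.
  intros HP Hs Ht Hst Hrt.
  exists (fun s => exists t, wf s /\ wf t /\ infred R P s t /\ inf_root t); split;
    [|exists t; auto].
  clear s t Hs Ht Hst Hrt. intros s (t & Hs & Ht & Hst & Hrt).
  destruct (inf_root_unfold Hrt) as (t1 & t2 & H1 & H2 & H3).
  pose proof (rtc_wf wf_R Ht H1) as Hw1.
  pose proof (infred_rtc_r HP Hs Ht Hst H1) as Hst1.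
  destruct (infred_root Hs Hw1 Hst1 H2) as (s1 & s2 & Hs1 & Hws1 & Hs2 & Hst2).
  exists s1, s2; splits; auto. exists t2; splits; auto.
  - exact (rootstep_wf wf_R Hws1 Hs2).
  - exact (rootstep_wf wf_R Hw1 H2).
Qed.

(** * Parallel steps and the strip lemma *)

Notation par := (lift (rootstep R)).

Lemma step_par p t u : wf t -> step R t p u -> par t u.
Proof.
  revert t u; induction p as [|i p IH]; intros t u Ht Hs; apply lift_fold.
  - left; now apply step_nil.
  - right. destruct (step_cons_inv Ht Hs) as (a & Ha & Hi & Ha' & Hs' & Hj).
    split; [congruence|]. intros b j Hb Hjb. destruct (Nat.eq_dec j i) as [->|Hne].
    + apply IH; [exact (wf_child Ht Ha Hi)|assumption].
    + rewrite Hj by assumption; apply lift_refl.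
Qed.

(** By non-overlap the parallel step takes place inside the substitution, so the redex survives.
    Contracting it copies or erases the inner redexes, and the copies are again disjoint, though
    possibly infinite in number. *)
Lemma par_redex l r sigma t : R (l, r) -> wf_subst ar sigma -> wf t ->
  same_node par (subst l sigma) t ->
  exists tau, wf_subst ar tau /\ t = subst l tau /\ par (subst r sigma) (subst r tau).
Proof.
  intros H Hw Ht Hn. destruct (HR H) as (Hl & Hr & Htl & Htr & _ & Hv).
  assert (Hs : wf (subst l sigma)) by now apply wf_subst_term.
  destruct (lift_match_root (B := rootstep R) (s := subst l sigma) (t := t) H)
    as [Hm Hvar]; auto using subst_matches.
  { intros q f s u Hq Hf Hws Hms. exact (no_overlap H Hq Hf Hws Hms (t := u)). }
  destruct (matches_subst Hl Htl (Hlin H) Ht Hm) as (tau & Hwt & -> & Hval).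
  exists tau; splits; auto. apply lift_subst; auto.
  intros p x Hx. destruct (Hv _ _ Hx) as [q Hq].
  rewrite <- (subst_at_var sigma Hl Htl Hq), (Hval _ _ Hq). exact (Hvar _ _ Hq).
Qed.

Lemma strip_root t u t' : wf t -> wf t' -> rootstep R t u -> par t t' ->
  t' = u \/ exists u', rootstep R t' u' /\ par u u'.
Proof.
  intros Ht Ht' (l & r & sg & H & Hw & -> & ->) Hp.
  destruct (lift_unfold Hp) as [Hr|Hn].
  - left. exact (redex_unique H Hw eq_refl Hr).
  - right. destruct (par_redex H Hw Ht' Hn) as (tau & Hwt & -> & Hpar).
    exists (subst r tau); split; [|assumption]. exists l, r, tau; auto.
Qed.

Lemma strip p t u t' : wf t -> wf t' -> step R t p u -> par t t' ->
  exists u', wf u' /\ par u u' /\ par t' u'.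
Proof.
  revert t u t'; induction p as [|i p IH]; intros t u t' Ht Ht' Hs Hp.
  - apply step_nil in Hs; [|assumption]. destruct (strip_root Ht Ht' Hs Hp) as [->|(u' & H1 & H2)].
    + exists u; splits; [assumption|apply lift_refl..].
    + exists u'; splits; [|assumption|apply lift_fold; now left].
      exact (rootstep_wf wf_R Ht' H1).
  - pose proof (step_wf wf_R Ht Hs) as Hu.
    destruct (step_cons_inv Ht Hs) as (a & Ha & Hi & Ha' & Hs' & Hj).
    destruct (lift_unfold Hp) as [(l & r & sg & H & Hw & -> & ->)|[He Hc]].
    + destruct (par_redex (t := u) H Hw Hu) as (tau & Hwt & -> & Hpar).
      { split; [congruence|]. intros b j Hb Hjb. destruct (Nat.eq_dec j i) as [->|Hne].
        - exact (step_par (wf_child Ht Ha Hi) Hs').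
        - rewrite Hj by assumption; apply lift_refl. }
      exists (subst r tau); splits; [|apply lift_fold; left; exists l, r, tau; auto|assumption].
      apply wf_subst_term; [assumption|exact (proj2 (wf_R H))].
    + assert (Hta' : t' [] = Some a) by congruence.
      destruct (IH (sub t i) (sub u i) (sub t' i)) as (v & Hv & Huv & Htv); auto.
      { exact (wf_child Ht Ha Hi). }
      { exact (wf_child Ht' Hta' Hi). }
      { exact (Hc a i Hta' Hi). }
      exists (update a t' i v); splits.
      * now apply wf_update.
      * apply lift_fold; right. split; [exact Ha'|]. intros b j [= <-] Hjb.
        destruct (Nat.eq_dec j i) as [->|Hne].
        -- now rewrite update_sub_eq.
        -- rewrite update_sub_neq, Hj by assumption. exact (Hc a j Hta' Hjb).
      * apply lift_fold; right. split; [exact Hta'|]. intros b j [= <-] Hjb.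
        destruct (Nat.eq_dec j i) as [->|Hne].
        -- now rewrite update_sub_eq.
        -- rewrite update_sub_neq by assumption. apply lift_refl.
Qed.

Notation red := (infred R inf_root).

(** Each step of the reduction is answered by a parallel step from [t0], which may be infinite and
    is absorbed into [red]; hence only the term [t'] has to be kept on that side. *)
Lemma strip_red t u : wf t -> rtc R t u -> forall t0 t', wf t0 -> wf t' ->
  par t t0 -> red t' t0 -> exists u', wf u' /\ par u u' /\ red t' u'.
Proof.
  intros Ht H. apply clos_rt_rt1n in H. revert Ht.
  induction H as [t|t v u [p Hp] _ IH]; intros Ht t0 t' H0 H' Hpar Hred; [eauto|].
  destruct (strip Ht H0 Hp Hpar) as (v' & Hv' & Hvv & H0v).
  apply (IH (step_wf wf_R Ht Hp) v' t'); auto.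
  exact (infred_par inf_root_rtc H' H0 Hv' Hred H0v).
Qed.

(* A root step may be absorbed by the parallel step, in which case the next root step of the
   given reduction serves instead. *)
Lemma inf_root_par t t0 t' : wf t -> wf t0 -> wf t' -> inf_root t -> par t t0 -> red t' t0 ->
  inf_root t'.
Proof.
  intros Ht H0 H' Hrt Hpar Hred.
  exists (fun t' => exists t t0, wf t /\ wf t0 /\ wf t' /\ inf_root t /\ par t t0 /\ red t' t0);
    split; [|exists t, t0; splits; assumption].
  clear t t0 t' Ht H0 H' Hrt Hpar Hred.
  intros t' (t & t0 & Ht & H0 & H' & Hrt & Hpar & Hred).
  destruct (inf_root_unfold Hrt) as (u & w & Htu & Huw & Hrw).
  pose proof (rtc_wf wf_R Ht Htu) as Hu.
  pose proof (rootstep_wf wf_R Hu Huw) as Hw.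
  destruct (strip_red Ht Htu H0 H' Hpar Hred) as (u' & Hu' & Huu & Hred').
  destruct (strip_root Hu Hu' Huw Huu) as [->|(w' & Hw' & Hww)].
  - destruct (inf_root_unfold Hrw) as (v & z & Hwv & Hvz & Hrz).
    pose proof (rtc_wf wf_R Hw Hwv) as Hv.
    pose proof (rootstep_wf wf_R Hv Hvz) as Hz.
    pose proof (infred_rtc_r inf_root_rtc H' Hw Hred' Hwv) as Hred2.
    destruct (infred_root H' Hv Hred2 Hvz) as (s1 & s2 & Hs1 & Hws1 & Hs2 & Hred3).
    exists s1, s2; splits; auto. exists z, z; splits; auto using lift_refl.
    exact (rootstep_wf wf_R Hws1 Hs2).
  - destruct (infred_root H' Hu' Hred' Hw') as (s1 & s2 & Hs1 & Hws1 & Hs2 & Hred3).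
    exists s1, s2; splits; auto. exists w, w'; splits; auto.
    + exact (rootstep_wf wf_R Hu' Hw').
    + exact (rootstep_wf wf_R Hws1 Hs2).
Qed.

Lemma inf_root_rtc_r t t' : wf t -> inf_root t -> rtc R t t' -> inf_root t'.
Proof.
  intros Ht Hrt H. apply clos_rt_rt1n in H. revert Ht Hrt.
  induction H as [t|t u t' [p Hp] _ IH]; [auto|]. intros Ht Hrt.
  pose proof (step_wf wf_R Ht Hp) as Hu. apply IH; [assumption|].
  apply (inf_root_par (t := t) (t0 := u)); auto.
  - exact (step_par Ht Hp).
  - apply infred_refl.
Qed.

(** * Root-active terms *)

Lemma total_subst r sigma : wf r -> total r ->
  (forall p x, r p = Some (Vr F x) -> total (sigma x)) -> total (subst r sigma).
Proof.
  intros Hr Ht Hv p; revert r Hr Ht Hv; induction p as [|i p IH]; intros r Hr Ht Hv;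
    destruct (wf_root Hr) as [[f|x|] Ha]; try (destruct (Ht _ Ha); fail).
  - rewrite (subst_fn_root _ Ha); congruence.
  - rewrite (subst_var _ Ha). exact (Hv _ _ Ha []).
  - change (sub (subst r sigma) i p <> Some (Bot F)). rewrite (subst_fn_sub _ i Ha).
    destruct (le_lt_dec (ar f) i) as [Hi|Hi].
    + rewrite subst_none by exact (wf_out [] Hr Ha Hi). congruence.
    + apply IH; auto using total_sub; [exact (wf_child Hr Ha Hi)|].
      intros q x Hq; exact (Hv (i :: q) x Hq).
  - rewrite (subst_var _ Ha). exact (Hv _ _ Ha (i :: p)).
Qed.

Lemma step_total p t t' : wf t -> total t -> step R t p t' -> total t'.
Proof.
  revert t t'; induction p as [|i p IH]; intros t t' Ht Htot Hs.
  - apply step_nil in Hs as (l & r & sg & H & Hw & -> & ->); [|assumption].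
    destruct (HR H) as (Hl & Hr & Htl & Htr & _ & Hv). apply total_subst; auto.
    intros q x Hx. destruct (Hv _ _ Hx) as [q' Hq'].
    rewrite <- (subst_at_var sg Hl Htl Hq'). intros q0; exact (Htot (q' ++ q0)).
  - destruct (step_cons_inv Ht Hs) as (a & Ha & Hi & Ha' & Hs' & Hj).
    intros [|j q].
    + rewrite Ha', <- Ha. apply Htot.
    + change (sub t' j q <> Some (Bot F)). destruct (Nat.eq_dec j i) as [->|Hne].
      * apply (IH _ _ (wf_child Ht Ha Hi) (fun q0 => Htot (i :: q0)) Hs').
      * rewrite Hj by assumption. apply Htot.
Qed.

Lemma rtc_total t t' : wf t -> total t -> rtc R t t' -> total t'.
Proof.
  intros Ht Htot H. apply clos_rt_rt1n in H. revert Ht Htot.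
  induction H as [t|t u t' [p Hp] _ IH]; [auto|]. intros Ht Htot. apply IH.
  - exact (step_wf wf_R Ht Hp).
  - exact (step_total Ht Htot Hp).
Qed.

Notation root_active := (@root_active F ar R).

Lemma redex_rootstep s : redex ar R s -> exists s', rootstep R s s'.
Proof. intros (l & r & sg & H & Hw & ->). exists (subst r sg), l, r, sg; auto. Qed.

Lemma inf_root_active t : wf t -> total t -> inf_root t -> root_active t.
Proof.
  intros Ht Htot Hrt; split; [|split]; auto. intros t' H.
  destruct (inf_root_unfold (inf_root_rtc_r Ht Hrt H)) as (u & v & Hu & (l & r & sg & H1 & Hw & -> & _) & _).
  exists (subst l sg); split; [assumption|]. exists l, r, sg; auto.
Qed.

Lemma root_active_rtc t t' : root_active t -> rtc R t t' -> root_active t'.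
Proof.
  intros (Ht & Htot & Hact) H; split; [|split].
  - exact (rtc_wf wf_R Ht H).
  - exact (rtc_total Ht Htot H).
  - intros u Hu. apply Hact. eapply rt_trans; eauto.
Qed.

Lemma root_active_rootstep t : root_active t ->
  exists u v, rtc R t u /\ rootstep R u v /\ root_active v.
Proof.
  intros H. destruct (proj2 (proj2 H) t (rt_refl _ _ _)) as (u & Hu & Hr).
  destruct (redex_rootstep Hr) as [v Hv]. exists u, v; splits; auto.
  apply (root_active_rtc H). eapply rt_trans; [exact Hu|].
  apply rtc_root; [|assumption]. exact (rtc_wf wf_R (proj1 H) Hu).
Qed.

(** Steps preserve the symbols of a proper subpattern of [l]. It would therefore still be present in
    the redex that a root-active term must reach, and would overlap with it. *)
Lemma root_active_no_match l r q f s : R (l, r) -> q <> [] -> l q = Some (Fn f) ->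
  matches (subterm l q) s -> ~ root_active s.
Proof.
  intros H Hq Hf Hm Hact. destruct (proj2 (proj2 Hact) s (rt_refl _ _ _)) as (u & Hu & Hr).
  assert (Hmu : wf u /\ matches (subterm l q) u).
  { pose proof (proj1 Hact) as Hs. clear Hact Hr. apply clos_rt_rt1n in Hu.
    induction Hu as [s|s v u [p Hp] _ IH]; [auto|].
    pose proof (step_wf wf_R Hs Hp) as Hv. apply IH; [|assumption].
    intros p' g Hg.
    apply (fun HB => proj1 (lift_match (B := rootstep R) H HB p' Hq Hs (step_par Hs Hp) Hm) g Hg).
    intros q' f' s' t' Hq' Hf' Hs' Hm'. exact (no_overlap H Hq' Hf' Hs' Hm' (t := t')). }
  destruct Hmu as [Hwu Hmu]. destruct (redex_rootstep Hr) as [v Hv].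
  exact (no_overlap H Hq Hf Hwu Hmu Hv).
Qed.

(** * The Böhm extension *)

Section Bind.
Variable k : sym -> option term.
Hypothesis k_fn : forall f, k (Fn f) = None.
Hypothesis k_wf : forall a u, k a = Some u -> wf u.

Lemma step_bind p t t' : wf t -> step R t p t' -> step R (bind k t) p (bind k t').
Proof.
  revert t t'; induction p as [|i p IH]; intros t t' Ht Hs.
  - apply step_nil in Hs as (l & r & sg & H & Hw & -> & ->); [|assumption].
    apply step_nil; [now apply wf_bind|].
    destruct (HR H) as (Hl & Hr & Htl & Htr & _).
    exists l, r, (fun x => bind k (sg x)); splits; auto using bind_subst.
    intros x; now apply wf_bind.
  - destruct (step_cons_inv Ht Hs) as (a & Ha & Hi & Ha' & Hs' & Hj).
    destruct a as [f|x|]; [|cbn in Hi; lia..].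
    apply step_cons with (a := Fn f).
    + now apply wf_bind.
    + now apply bind_root.
    + now apply bind_root.
    + rewrite (bind_sub i Ha (k_fn f)), (bind_sub i Ha' (k_fn f)).
      apply IH; [exact (wf_child Ht Ha Hi)|assumption].
    + intros j Hne. rewrite (bind_sub j Ha (k_fn f)), (bind_sub j Ha' (k_fn f)).
      now rewrite Hj.
Qed.

Lemma rtc_bind t t' : wf t -> rtc R t t' -> rtc R (bind k t) (bind k t').
Proof.
  intros Ht H. apply clos_rt_rt1n in H. revert Ht.
  induction H as [t|t u t' [p Hp] _ IH]; intros Ht; [apply rt_refl|].
  eapply rtc_step; [exists p; exact (step_bind Ht Hp)|].
  apply IH; exact (step_wf wf_R Ht Hp).
Qed.

Lemma inf_root_bind t : wf t -> inf_root t -> inf_root (bind k t).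
Proof.
  intros Ht Hrt. exists (fun s => exists t, wf t /\ inf_root t /\ s = bind k t); split;
    [|exists t; auto].
  clear t Ht Hrt. intros s (t & Ht & Hrt & ->).
  destruct (inf_root_unfold Hrt) as (u & v & H1 & H2 & H3).
  pose proof (rtc_wf wf_R Ht H1) as Hu.
  pose proof (rootstep_wf wf_R Hu H2) as Hv.
  exists (bind k u), (bind k v); splits; [now apply rtc_bind| |exists v; auto].
  apply step_nil; [now apply wf_bind|]. apply step_bind; [assumption|]. now apply step_nil.
Qed.
End Bind.

Lemma wf_ksub sigma : wf_subst ar sigma -> forall a u, ksub sigma a = Some u -> wf u.
Proof. intros Hw [f|x|] u; cbn; intros [= <-]; apply Hw. Qed.

Lemma wf_kbot v : wf v -> forall a u, kbot v a = Some u -> wf u.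
Proof. intros Hw [f|x|] u; cbn; intros [= <-]; exact Hw. Qed.

Lemma total_kbot v t : total v -> total (bind (kbot v) t).
Proof.
  intros Hv p; revert t; induction p as [|i p IH]; intros t;
    (destruct (t []) as [a|] eqn:Ha; [|now rewrite bind_none]);
    (destruct (kbot v a) as [u|] eqn:Hk;
     [rewrite (bind_hit Ha Hk); destruct a; try discriminate; injection Hk as <-; apply Hv|]).
  - rewrite (bind_root Ha Hk). intros [= ->]; discriminate.
  - change (sub (bind (kbot v) t) i p <> Some (Bot F)).
    rewrite (bind_sub i Ha Hk). apply IH.
Qed.

(* Filling the holes with a variable gives a root-active term, which may then fill the holes
   itself. *)
Lemma inf_root_U_bot s : wf s -> inf_root s -> U_bot ar R s.
Proof.
  intros Hs Hrt; split; [assumption|].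
  assert (Hact : forall v, wf v -> total v -> root_active (bind (kbot v) s)).
  { intros v Hv Htot. apply inf_root_active.
    - apply wf_bind; [now apply wf_kbot|assumption].
    - now apply total_kbot.
    - apply inf_root_bind; auto. now apply wf_kbot. }
  assert (Hvar : root_active (bind (kbot (var 0)) s)).
  { apply Hact; [apply wf_var|]. intros [|i p]; discriminate. }
  exists (fun _ => bind (kbot (var 0)) s); split; [auto|].
  rewrite fill_bind. apply Hact; apply Hvar.
Qed.

(** When lifted, it relates the filled term on the left to the term with holes on the right. *)
Definition hole_active (v u : term) : Prop := u = bot /\ root_active v.

Lemma fill_lift u f : wf u -> (forall p, u p = Some (Bot F) -> root_active (f p)) ->
  lift hole_active (fill u f) u.
Proof.
  intros Hu Hf.
  apply (gfp_coind (X := fun v u => exists f, wf u /\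
    (forall p, u p = Some (Bot F) -> root_active (f p)) /\ v = fill u f)
    (@liftF_mono hole_active)); [|eauto].
  clear u f Hu Hf. intros v u (f & Hu & Hf & ->).
  destruct (wf_root Hu) as [a Ha]. right.
  destruct (classic (a = Bot F)) as [->|Hne].
  - left; split; [now apply root_bot|].
    replace (fill u f) with (f []); [now apply Hf|].
    apply term_ext; intros p; unfold fill. destruct p; cbn; now rewrite Ha.
  - right; split.
    + unfold fill; cbn; rewrite Ha. destruct a; congruence.
    + intros b i Hb Hi. assert (b = a) by congruence; subst b.
      left. exists (fun q => f (i :: q)); splits.
      * exact (wf_child Hu Ha Hi).
      * intros p Hp; exact (Hf (i :: p) Hp).
      * apply term_ext; intros p; unfold sub at 1; unfold fill.
        rewrite graft_cons with (a := a); [reflexivity|assumption|]. destruct a; congruence.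
Qed.

(** No hole can interrupt the pattern below its root, because a root-active term matches no proper
    subpattern. *)
Lemma hole_active_rootstep v v' u : wf v -> wf u -> lift hole_active v u -> rootstep R v v' ->
  u = bot \/ exists u', rootstep R u u' /\ lift hole_active v' u'.
Proof.
  intros Hv Hu Hvu (l & r & sg & H & Hw & -> & ->).
  destruct (lift_unfold Hvu) as [[Hb _]|Hn]; [now left|right].
  destruct (HR H) as (Hl & Hr & Htl & Htr & _ & Hvars).
  destruct (lift_match_root (B := hole_active) (s := subst l sg) (t := u) H)
    as [Hm Hvar]; auto using subst_matches.
  { intros q f s t Hq Hf _ Hms [_ Hact]. exact (root_active_no_match H Hq Hf Hms Hact). }
  destruct (matches_subst Hl Htl (Hlin H) Hu Hm) as (tau & Hwt & -> & Hval).
  exists (subst r tau); split; [exists l, r, tau; auto|]. apply lift_subst; auto.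
  intros p x Hx. destruct (Hvars _ _ Hx) as [q Hq].
  rewrite <- (subst_at_var sg Hl Htl Hq), (Hval _ _ Hq). exact (Hvar _ _ Hq).
Qed.

Lemma hole_active_step p v v' u : wf v -> wf u -> lift hole_active v u -> step R v p v' ->
  lift hole_active v' u \/ exists u', step R u p u' /\ lift hole_active v' u'.
Proof.
  revert v v' u; induction p as [|i p IH]; intros v v' u Hv Hu Hvu Hs;
    (destruct (lift_unfold Hvu) as [[-> Hact]|[He Hc]];
     (* A step inside the content of a hole keeps it root-active, and [u] does not move. *)
     [left; apply lift_fold; left; split; [reflexivity|];
      apply (root_active_rtc Hact); apply rt_step; eexists; exact Hs|]).
  - apply step_nil in Hs; [|assumption].
    destruct (hole_active_rootstep Hv Hu Hvu Hs) as [->|(u' & H1 & H2)].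
    + exfalso. destruct Hs as (l & r & sg & H & _ & -> & _).
      destruct (lhs_root H) as [f Hf]. rewrite (subst_fn_root _ Hf) in He. discriminate.
    + right; exists u'; split; [now apply step_nil|assumption].
  - destruct (step_cons_inv Hv Hs) as (a & Ha & Hi & Ha' & Hs' & Hj).
    assert (Hua : u [] = Some a) by congruence.
    destruct (IH (sub v i) (sub v' i) (sub u i)) as [H1|(w & Hw & H1)]; auto.
    + exact (wf_child Hv Ha Hi).
    + exact (wf_child Hu Hua Hi).
    + exact (Hc a i Hua Hi).
    + left. apply lift_fold; right; split; [congruence|]. intros b j Hb Hjb.
      destruct (Nat.eq_dec j i) as [->|Hne]; [assumption|].
      rewrite Hj by assumption. exact (Hc b j Hb Hjb).
    + right. exists (update a u i w); split; [now apply step_update|].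
      apply lift_fold; right; split; [exact Ha'|]. intros b j [= <-] Hjb.
      destruct (Nat.eq_dec j i) as [->|Hne].
      * now rewrite update_sub_eq.
      * rewrite update_sub_neq, Hj by assumption. exact (Hc a j Hua Hjb).
Qed.

Lemma hole_active_rtc v v' u : wf v -> wf u -> lift hole_active v u -> rtc R v v' ->
  exists u', rtc R u u' /\ lift hole_active v' u'.
Proof.
  intros Hv Hu Hvu H. apply clos_rt_rt1n in H. revert u Hv Hu Hvu.
  induction H as [v|v w v' [p Hp] _ IH]; intros u Hv Hu Hvu.
  - exists u; split; [apply rt_refl|assumption].
  - pose proof (step_wf wf_R Hv Hp) as Hw.
    destruct (hole_active_step Hv Hu Hvu Hp) as [H1|(u1 & Hu1 & H1)].
    + auto.
    + pose proof (step_wf wf_R Hu Hu1) as Hwu1.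
      destruct (IH u1 Hw Hwu1 H1) as (u' & Hu' & H2).
      exists u'; split; [|assumption]. eapply rtc_step; [exists p|]; eassumption.
Qed.

(** The root steps of the root-active instance are mirrored by [u] unless the root of [u] becomes a
    hole, that is, unless [u] has reduced to bottom. *)
Lemma U_bot_collapse u : U_bot ar R u -> rtc R u bot \/ inf_root u.
Proof.
  intros (Hu & f & Hf & Hact).
  destruct (classic (rtc R u bot)) as [Hb|Hb]; [now left|right].
  exists (fun u => wf u /\ ~ rtc R u bot /\ exists v, root_active v /\ lift hole_active v u).
  split; [|splits; auto; exists (fill u f); split; [assumption|now apply fill_lift]].
  clear u f Hu Hf Hact Hb. intros u (Hu & Hb & v & Hact & Hvu).
  destruct (root_active_rootstep Hact) as (v1 & v2 & H1 & H2 & Hact2).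
  destruct (hole_active_rtc (proj1 Hact) Hu Hvu H1) as (u1 & Hu1 & Hvu1).
  pose proof (rtc_wf wf_R Hu Hu1) as Hwu1.
  pose proof (rtc_wf wf_R (proj1 Hact) H1) as Hwv1.
  destruct (hole_active_rootstep Hwv1 Hwu1 Hvu1 H2) as [->|(u2 & Hu2 & Hvu2)]; [contradiction|].
  exists u1, u2; splits; auto.
  - exact (rootstep_wf wf_R Hwu1 Hu2).
  - intros Hb2; apply Hb. eapply rt_trans; [exact Hu1|].
    eapply rt_trans; [exact (rtc_root Hwu1 Hu2)|assumption].
  - exists v2; auto.
Qed.

Notation B := (bohm ar R).

Lemma wf_bohm : wf_trs B.
Proof.
  intros l r [H|(H & _ & Hr)]; [exact (wf_R H)|]. cbn in H, Hr; subst r.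
  split; [apply H|apply wf_bot].
Qed.

Lemma red_bohm_root s t t' : wf s -> wf t -> red s t -> rootstep B t t' -> red s t'.
Proof.
  intros Hs Ht Hst (l & r & sg & [H|(H & _ & Hr)] & Hw & -> & ->).
  - apply (infred_step inf_root_rtc (p := []) Hs Ht Hst).
    apply step_nil; [assumption|]. exists l, r, sg; auto.
  (* The left-hand side of a Böhm rule may contain variables; both outcomes for [l] carry over to
     its instance, substitution being a [bind]. *)
  - cbn in H, Hr; subst r. rewrite subst_bot.
    destruct (U_bot_collapse H) as [Hb|Hb].
    + apply (infred_rtc_r inf_root_rtc Hs Ht Hst).
      rewrite <- (subst_bot sg). rewrite !subst_bind.
      apply rtc_bind; [reflexivity|now apply wf_ksub|apply H|assumption].
    + apply infred_fold; left; split; [reflexivity|].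
      apply (infred_inf_root inf_root_rtc Hs Ht Hst).
      rewrite subst_bind. apply inf_root_bind; [reflexivity|now apply wf_ksub|apply H|assumption].
Qed.

Lemma red_bohm_step p s t t' : wf s -> wf t -> red s t -> step B t p t' -> red s t'.
Proof. exact (infred_step_of_root wf_bohm red_bohm_root (p := p) (s := s) (t := t) (t' := t')). Qed.

(** Böhm rules exclude bottom as a left-hand side; this shows that a term with infinitely many root
    steps is a legitimate one. *)
Lemma inf_root_bot : ~ inf_root bot.
Proof.
  intros H. destruct (inf_root_unfold H) as (u & v & Hu & Hv & _).
  assert (u = bot) as ->.
  { apply clos_rt_rt1n in Hu. remember bot as b eqn:E. destruct Hu as [|w u [p Hp] _]; [auto|].
    exfalso. subst b. destruct p as [|i p].
    - apply step_nil in Hp as (l & r & sg & Hl & _ & E & _); [|apply wf_bot].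
      destruct (lhs_root Hl) as [f Hf]. apply (subst_fn_root sg) in Hf.
      rewrite <- E in Hf; discriminate.
    - destruct (step_cons_inv (wf_bot) Hp) as (a & [= <-] & Hi & _). cbn in Hi; lia. }
  destruct Hv as (l & r & sg & Hl & _ & E & _).
  destruct (lhs_root Hl) as [f Hf]. apply (subst_fn_root sg) in Hf.
  rewrite <- E in Hf; discriminate.
Qed.

Lemma red_infred_bohm s t : wf s -> red s t -> infred B (fun _ => False) s t.
Proof.
  intros Hs Hst.
  apply (gfp_coind (X := fun s t => wf s /\ red s t) (@infredF_mono B (fun _ => False)));
    [|auto].
  clear s t Hs Hst. intros s t [Hs Hst]. right; right.
  destruct (infred_unfold Hst) as [[-> Hrt]|(s' & Hs' & He & Hc)].
  - exists bot; split; [|split; [reflexivity|intros a i [= <-] Hi; cbn in Hi; lia]].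
    apply rtc_root; [assumption|]. exists s, bot, var; splits.
    + right; cbn; splits; auto using inf_root_U_bot.
      intros ->; exact (inf_root_bot Hrt).
    + intros x; apply wf_var.
    + now rewrite subst_id.
    + now rewrite subst_bot.
  - pose proof (rtc_wf wf_R Hs Hs') as Hw. exists s'; split.
    + apply (rtc_mono (S := R)); [now left|assumption].
    + split; [assumption|]. intros a i Ha Hi. left; split; [|exact (Hc a i Ha Hi)].
      refine (wf_child Hw _ Hi); congruence.
Qed.

(** * Transfinite reductions are absorbed *)

Section Ordinal.
Variable I : Type.
Variable lt : I -> I -> Prop.
Hypothesis Hwo : wellorder lt.

Notation ltO := (@ltO I lt).
Notation leO := (@leO I lt).

Lemma ltO_trans x y z : ltO x y -> ltO y z -> ltO x z.
Proof.
  destruct x, y, z; cbn; try tauto. apply (wo_trans Hwo).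
Qed.

Lemma ltO_total x y : ltO x y \/ x = y \/ ltO y x.
Proof.
  destruct x as [a|], y as [b|]; cbn; auto.
  destruct (wo_total Hwo a b) as [H|[->|H]]; auto.
Qed.

Lemma ltO_wf : well_founded ltO.
Proof.
  assert (H : forall a, Acc ltO (Some a)).
  { intros a; induction (wo_wf Hwo a) as [a _ IH]. constructor; intros [b|]; cbn; [auto|tauto]. }
  intros [a|]; [apply H|]. constructor; intros [b|]; cbn; [intros _; apply H|tauto].
Qed.

Lemma ltO_irrefl x : ~ ltO x x.
Proof. induction (ltO_wf x) as [x _ IH]. intros H; exact (IH x H H). Qed.

Lemma leO_refl x : leO x x.
Proof. now left. Qed.

Lemma leO_trans x y z : leO x y -> leO y z -> leO x z.
Proof. intros [->|H] [->|H']; unfold Defs.leO; eauto using ltO_trans. Qed.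

Lemma leO_ltO x y z : leO x y -> ltO y z -> ltO x z.
Proof. intros [->|H] H'; eauto using ltO_trans. Qed.

Lemma ltO_leO x y z : ltO x y -> leO y z -> ltO x z.
Proof. intros H [->|H']; eauto using ltO_trans. Qed.

Lemma not_ltO x y : ~ ltO x y -> leO y x.
Proof. intros H; destruct (ltO_total x y) as [H'|[->|H']]; [tauto|now left|now right]. Qed.

Lemma ltO_some x y : ltO x y -> exists i, x = Some i.
Proof. destruct x; [eauto|destruct y; cbn; tauto]. Qed.

Lemma ord_cases x :
  (forall y, leO x y) \/ (exists i, is_succ lt (Some i) x) \/ is_limit lt x.
Proof.
  destruct (classic (exists y, ltO y x)) as [Hex|Hno']; [right|left].
  - destruct (classic (exists y, is_succ lt y x)) as [[y Hy]|Hn]; [left|right].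
    + destruct (ltO_some (proj1 Hy)) as [i ->]; eauto.
    + split; [assumption|]. intros y Hy. apply NNPP; intros Hz; apply Hn.
      exists y; split; [assumption|]. intros z H1 H2; apply Hz; eauto.
  - intros y; apply not_ltO; intros H; apply Hno'; eauto.
Qed.

Lemma succ_exists i x : ltO (Some i) x -> exists y, is_succ lt (Some i) y /\ leO y x.
Proof.
  induction (ltO_wf x) as [x _ IH]. intros Hx.
  destruct (classic (is_succ lt (Some i) x)) as [Hs|Hs]; [exists x; split; [assumption|apply leO_refl]|].
  assert (Hz : exists z, ltO (Some i) z /\ ltO z x).
  { apply NNPP; intros Hn; apply Hs; split; [assumption|]. intros z H1 H2; apply Hn; eauto. }
  destruct Hz as (z & H1 & H2). destruct (IH z H2 H1) as (y & Hy & Hyz).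
  exists y; split; [assumption|]. right; eapply leO_ltO; eauto.
Qed.

Lemma succ_le i x y : is_succ lt (Some i) x -> ltO y x -> leO y (Some i).
Proof. intros [_ H] Hy. apply not_ltO; intros H'; exact (H y H' Hy). Qed.

Lemma limit_succ lam i y : is_limit lt lam -> ltO (Some i) lam -> is_succ lt (Some i) y -> ltO y lam.
Proof.
  intros [_ Hl] Hi [_ Hs]. destruct (Hl _ Hi) as (z & H1 & H2).
  refine (leO_ltO (y := z) _ H2). apply not_ltO; intros H; exact (Hs z H1 H).
Qed.

Lemma least_index : exists x, forall y, leO x y.
Proof.
  apply NNPP; intros Hn. assert (H : forall x : option I, False); [|exact (H None)].
  intros x; induction (ltO_wf x) as [x _ IH]. apply Hn; exists x; intros y.
  apply not_ltO; intros H; exact (IH y H).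
Qed.

Lemma ltO_max b c lam : ltO (Some b) lam -> ltO (Some c) lam ->
  exists d, leO (Some b) (Some d) /\ leO (Some c) (Some d) /\ ltO (Some d) lam.
Proof.
  intros Hb Hc. destruct (ltO_total (Some b) (Some c)) as [Hbc|[Hbc|Hbc]].
  - exists c; splits; [now right|apply leO_refl|assumption].
  - exists c; splits; [now left|apply leO_refl|assumption].
  - exists b; splits; [apply leO_refl|now right|assumption].
Qed.

Definition strict_prefix (p q : pos) : Prop := prefix p q /\ p <> q.

Lemma strict_prefix_snoc p q i : strict_prefix p (q ++ [i]) -> prefix p q.
Proof.
  intros [[r Hr] Hne]. destruct r as [|j r] using rev_ind.
  - rewrite app_nil_r in Hr; congruence.
  - rewrite app_assoc in Hr. apply app_inj_tail in Hr as [-> _]. now exists r.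
Qed.

Section Absorb.
Variable ts : option I -> term.
Variable ps : I -> pos.
Hypothesis Hred : reduction ar B lt ts ps.

Lemma ts_wf x : wf (ts x).
Proof. apply Hred. Qed.

Lemma ts_step i y : is_succ lt (Some i) y -> step B (ts (Some i)) (ps i) (ts y).
Proof. apply Hred. Qed.

Lemma ps_defined i : ts (Some i) (ps i) <> None.
Proof.
  destruct (succ_exists (i := i) (x := None)) as (y & Hy & _); [exact Logic.I|].
  now destruct (ts_step Hy) as (l & r & sg & _ & _ & H & _).
Qed.

Definition avoids (P : pos -> Prop) (x y : option I) : Prop :=
  forall i, leO x (Some i) -> ltO (Some i) y -> ~ P (ps i).

Lemma avoids_weaken (P : pos -> Prop) x y x' y' :
  leO x x' -> leO y' y -> avoids P x y -> avoids P x' y'.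
Proof.
  intros Hx Hy H i H1 H2; apply H; [eapply leO_trans|eapply ltO_leO]; eauto.
Qed.

(* What the transfinite absorption argument needs to know at limit ordinals: below a
   position that is not touched from above, either the label is eventually frozen, or it
   becomes bottom after cofinally many contractions at that very position. *)
Definition limit_behaviour : Prop :=
  forall lam b p, is_limit lt lam -> ltO (Some b) lam ->
    avoids (fun q => strict_prefix q p) (Some b) lam -> ts (Some b) p <> None ->
    (exists c, leO (Some b) (Some c) /\ ltO (Some c) lam /\
       avoids (fun q => prefix q p) (Some c) lam /\ ts lam p = ts (Some c) p) \/
    (ts lam p = Some (Bot F) /\
     forall c, leO (Some b) (Some c) -> ltO (Some c) lam ->
       exists i y, leO (Some c) (Some i) /\ ltO (Some i) lam /\ ps i = p /\
         is_succ lt (Some i) y /\ step R (ts (Some i)) (ps i) (ts y)).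

Hypothesis Hlim : limit_behaviour.

Lemma subterm_wf x p : ts x p <> None -> wf (subterm (ts x) p).
Proof. apply wf_subterm, ts_wf. Qed.

(** Stated for every position and every intermediate time, because the limit case continues with the
    children from the moment at which the parent is frozen. Only contractions strictly above [p] are
    excluded; those at [p] are absorbed. *)
Definition absorbs (x : option I) : Prop := forall p y s, leO y x -> wf s ->
  avoids (fun q => strict_prefix q p) y x -> ts y p <> None -> red s (subterm (ts y) p) ->
  ts x p <> None /\ red s (subterm (ts x) p).

Lemma absorbs_limit lam : is_limit lt lam -> (forall x, ltO x lam -> absorbs x) -> absorbs lam.
Proof.
  intros Hl IH p y s [->|Hy] Hs Hav Hp Hst; [auto|].
  destruct (ltO_some Hy) as [b ->].
  split.
  { destruct (Hlim Hl Hy Hav Hp) as [(c & Hbc & Hc & _ & ->)|[-> _]]; [|congruence].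
    apply (IH _ Hc p _ s Hbc); auto. eapply avoids_weaken; eauto; [apply leO_refl|now right]. }
  (* The time [b] belongs to the invariant: deeper positions may come to rest only later. *)
  apply (gfp_coind (X := fun u v => exists p b, ltO (Some b) lam /\ wf u /\
      avoids (fun q => strict_prefix q p) (Some b) lam /\ ts (Some b) p <> None /\
      red u (subterm (ts (Some b)) p) /\ v = subterm (ts lam) p) (@infredF_mono R inf_root));
    [|exists p, b; auto 10].
  clear p b s Hy Hs Hav Hp Hst.
  intros s v (p & b & Hb & Hs & Hav & Hp & Hst & ->). right.
  assert (Hbefore : forall c, leO (Some b) (Some c) -> ltO (Some c) lam ->
    ts (Some c) p <> None /\ red s (subterm (ts (Some c)) p)).
  { intros c Hbc Hc. apply (IH _ Hc p _ s Hbc); auto.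
    eapply avoids_weaken; eauto; [apply leO_refl|now right]. }
  destruct (Hlim Hl Hb Hav Hp) as [(c & Hbc & Hc & Hav' & He)|[He Hvol]].
  - destruct (Hbefore c Hbc Hc) as [Hpc Hsc].
    assert (Hpl : ts lam p <> None) by congruence.
    destruct (infred_unfold Hsc) as [[Hb0 Hrt]|(s' & Hs' & He' & Hch)].
    + left; split; [|assumption]. apply root_bot; [now apply subterm_wf|].
      rewrite subterm_root, He, <- subterm_root, Hb0. reflexivity.
    + right; exists s'; split; [assumption|].
      rewrite subterm_root in He'. split; [rewrite subterm_root; congruence|].
      intros a i Ha Hi. rewrite subterm_root in Ha. left.
      assert (Hac : ts (Some c) p = Some a) by congruence.
      exists (p ++ [i]), c; splits; auto.
      * refine (wf_child (rtc_wf wf_R Hs Hs') _ Hi); congruence.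
      * intros j H1 H2 H3. apply (Hav' j H1 H2). eapply strict_prefix_snoc; eauto.
      * apply (proj2 (ts_wf (Some c)) p i). eauto.
      * rewrite <- subterm_app. apply (Hch a i); [now rewrite subterm_root|assumption].
      * now rewrite <- subterm_app.
  - left; split.
    { apply root_bot; [apply subterm_wf; congruence|]. now rewrite subterm_root. }
    (* Each of the cofinally many contractions at [p] is replayed as a root step after [s], and the
       replay resumes at the following index. *)
    exists (fun u => exists c, leO (Some b) (Some c) /\ ltO (Some c) lam /\ wf u /\
      ts (Some c) p <> None /\ red u (subterm (ts (Some c)) p)); split;
      [|exists b; splits; auto using leO_refl].
    clear s Hs Hst Hbefore. intros s (c & Hbc & Hc & Hs & Hpc & Hsc).
    destruct (Hvol c Hbc Hc) as (i & y & Hci & Hi & Hpi & Hsucc & Hstep).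
    assert (Hyl : ltO y lam) by (eapply limit_succ; eauto).
    destruct (ltO_some Hyl) as [j ->].
    destruct (IH _ Hi p _ s Hci Hs) as [Hpi' Hsi]; auto.
    { eapply avoids_weaken; eauto. now right. }
    assert (Hroot : rootstep R (subterm (ts (Some i)) p) (subterm (ts (Some j)) p)).
    { apply step_nil; [now apply subterm_wf|]. apply step_inside; [apply ts_wf|].
      rewrite app_nil_r. congruence. }
    destruct (infred_root Hs (subterm_wf Hpi') Hsi Hroot) as (s1 & s2 & H1 & Hw1 & H2 & H3).
    exists s1, s2; splits; auto. exists j; splits; auto.
    + eapply leO_trans; [exact Hbc|]. eapply leO_trans; [exact Hci|]. right; apply Hsucc.
    + exact (rootstep_wf wf_R Hw1 H2).
    + apply wf_subterm_defined. exact (rootstep_wf wf_R (subterm_wf Hpi') Hroot).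
Qed.

Lemma absorbs_all x : absorbs x.
Proof.
  induction (ltO_wf x) as [x _ IH].
  destruct (ord_cases x) as [Hmin|[[i Hi]|Hl]].
  - intros p y s [->|Hy]; [auto|]. destruct (ltO_irrefl (x := x)).
    eapply leO_ltO; [apply Hmin|exact Hy].
  - intros p y s [->|Hy] Hs Hav Hp Hst; [auto|].
    pose proof (succ_le Hi Hy) as Hyi. destruct Hi as [Hix Hbetween].
    destruct (IH _ Hix p y s) as [Hpi Hsi]; auto.
    { eapply avoids_weaken; eauto; [apply leO_refl|now right]. }
    pose proof (ts_step (conj Hix Hbetween)) as Hstep.
    pose proof (Hav i Hyi Hix) as Hn.
    destruct (classic (prefix p (ps i))) as [[q Hq]|Hpq].
    + rewrite Hq in Hstep. apply step_inside in Hstep; [|apply ts_wf].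
      split.
      * apply wf_subterm_defined. exact (step_wf wf_bohm (subterm_wf Hpi) Hstep).
      * exact (red_bohm_step Hs (subterm_wf Hpi) Hsi Hstep).
    + assert (Hqp : ~ prefix (ps i) p).
      { intros H; apply Hn; split; [assumption|]. intros E; apply Hpq; rewrite E; apply prefix_refl. }
      split.
      * rewrite (step_label (ts_wf _) Hstep Hqp). assumption.
      * rewrite (step_outside (ts_wf _) Hstep Hqp Hpq). assumption.
  - now apply absorbs_limit.
Qed.

Lemma red_of_reduction s : starts_at lt ts s -> red s (ts None).
Proof.
  intros Hstart. destruct least_index as [x Hx]. rewrite <- (Hstart x Hx).
  destruct (absorbs_all (x := None) (p := []) (y := x) (s := ts x)) as [_ H]; auto using ts_wf.
  - intros i _ _ [[r Hr] Hne]. destruct (ps i); [congruence|discriminate].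
  - exact (proj1 (ts_wf x)).
  - apply infred_refl.
Qed.
End Absorb.

(** * Behaviour of both kinds of convergence at limit ordinals *)

Lemma m_limit_behaviour ts ps : reduction ar B lt ts ps ->
  (forall lam, is_limit lt lam -> forall n, exists b, ltO (Some b) lam /\
     forall i, leO (Some b) (Some i) -> ltO (Some i) lam ->
       (forall p, length p <= n -> ts (Some i) p = ts lam p) /\ n <= length (ps i)) ->
  limit_behaviour ts ps.
Proof.
  intros Hred Hm lam b p Hl Hb Hav Hp. left.
  (* Contractions deeper than [length p] cannot be at a prefix of [p], not even at [p]. *)
  destruct (Hm lam Hl (Datatypes.S (length p))) as (c & Hc & H).
  destruct (ltO_max Hb Hc) as (d & Hbd & Hcd & Hd). exists d; splits; auto.
  - intros i H1 H2 H3. destruct (H i) as [_ Hlen]; [eapply leO_trans; eauto|assumption|].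
    apply prefix_length in H3. lia.
  - destruct (H d Hcd Hd) as [H1 _]. symmetry; apply H1; lia.
Qed.

(** The least partial term with the labels of [d] along the path to [p]. It lies below every term
    that agrees with [d] there, hence below their infimum; it thus transports a stable label into a
    limit inferior. *)
Fixpoint trunc (d : term) (p : pos) : term :=
  match d [] with
  | None => bot
  | Some a =>
    match p with
    | [] => node a (fun _ => bot)
    | i :: p' => node a (fun j => if Nat.eq_dec j i then trunc (sub d i) p' else bot)
    end
  end.

Lemma wf_trunc d p : wf (trunc d p).
Proof.
  revert d; induction p as [|i p IH]; intros d; cbn; destruct (d []) as [a|]; try apply wf_bot;
    apply wf_node; intros j Hj; [apply wf_bot|].
  destruct (Nat.eq_dec j i); [apply IH|apply wf_bot].
Qed.

Lemma trunc_end d p : wf d -> d p <> None -> trunc d p p = d p.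
Proof.
  revert d; induction p as [|i p IH]; intros d Hd Hp; destruct (wf_root Hd) as [a Ha];
    cbn; rewrite Ha; [reflexivity|]. cbn.
  destruct (le_lt_dec (arity a) i) as [Hi|Hi].
  { rewrite (wf_out p Hd Ha Hi) in Hp; congruence. }
  destruct (lt_dec i (arity a)); [|lia]. destruct (Nat.eq_dec i i); [|lia].
  apply IH; [exact (wf_child Hd Ha Hi)|assumption].
Qed.

Lemma pleq_bot t : wf t -> pleq bot t.
Proof. intros [H _] [|i p]; cbn; auto. Qed.

Lemma pleq_node a w t : wf t -> t [] = Some a ->
  (forall i, i < arity a -> pleq (w i) (sub t i)) -> pleq (node a w) t.
Proof.
  intros Ht Ha H [|i p]; cbn; [auto|]. destruct (lt_dec i (arity a)); [|auto]. apply H; assumption.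
Qed.

Lemma trunc_le d e p : wf e -> wf d -> d p <> None ->
  (forall q, prefix q p -> e q = d q) -> pleq (trunc d p) e.
Proof.
  revert d e; induction p as [|i p IH]; intros d e He Hd Hp Hq; destruct (wf_root Hd) as [a Ha];
    assert (Hea : e [] = Some a) by (rewrite Hq; [assumption|apply prefix_nil]);
    cbn; rewrite Ha; apply pleq_node; auto; intros j Hj; pose proof (wf_child He Hea Hj) as Hej.
  - now apply pleq_bot.
  - destruct (Nat.eq_dec j i) as [->|Hne]; [|now apply pleq_bot].
    apply IH; auto; [exact (wf_child Hd Ha Hj)|].
    intros q Hqp. apply (Hq (i :: q)). now apply prefix_cons.
Qed.

(** The argument bounds [u] from below, so a bottom label yields definedness only; [liminf_bot]
    supplies the bound from above. *)
Lemma liminf_stable (c : I -> term) lam u d g p : is_liminf ar lt c lam u ->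
  (forall i, wf (c i)) -> wf d -> d p <> None -> ltO (Some g) lam ->
  (forall i q, leO (Some g) (Some i) -> ltO (Some i) lam -> prefix q p -> c i q = d q) ->
  u p <> None /\ (d p <> Some (Bot F) -> u p = d p).
Proof.
  intros (m & Hglb & Hu & Hub & _) Hc Hd Hp Hg Hst.
  destruct (Hglb g Hg) as (Hmw & _ & Hgreatest).
  assert (H1 : pleq (trunc d p) (m g)).
  { apply Hgreatest; [apply wf_trunc|]. intros v (i & Hi & Hil & ->).
    apply trunc_le; auto. }
  assert (H2 : pleq (m g) u) by (apply Hub; eauto).
  pose proof (trunc_end Hd Hp) as He.
  destruct (H1 p) as [H|[[H H']|H]]; [congruence| |];
    (destruct (H2 p) as [K|[[K K']|K]]; [congruence| |]); split; try congruence.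
Qed.

(** Every infimum of a tail is bottom or undefined at [p], so cutting [u] at [p] leaves an upper
    bound of these infima. By leastness [u] lies below its own cut. *)
Lemma liminf_bot (c : I -> term) lam u p : is_liminf ar lt c lam u ->
  (forall b, ltO (Some b) lam -> exists i, leO (Some b) (Some i) /\ ltO (Some i) lam /\
     c i p = Some (Bot F)) ->
  u p = None \/ u p = Some (Bot F).
Proof.
  intros (m & Hglb & Hu & Hub & Hleast) Hcof.
  destruct (u p) as [a|] eqn:Ha; [right|auto].
  assert (Hup : u p <> None) by congruence.
  assert (Hw : wf (replace u p bot)) by (apply wf_replace; auto using wf_bot).
  assert (Hle : pleq u (replace u p bot)).
  { apply Hleast; [assumption|]. intros v (b & Hb & ->) q.
    destruct (classic (prefix p q)) as [[r ->]|Hpq].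
    - destruct (Hglb b Hb) as (Hmw & Hlow & _).
      destruct (Hcof b Hb) as (i & Hi & Hil & Hbot).
      assert (Hmp : m b p = None \/ m b p = Some (Bot F)).
      { destruct (Hlow (c i)) with (p := p) as [H|[[H _]|H]]; [eauto|auto..].
        right; congruence. }
      destruct r as [|j r].
      + rewrite app_nil_r. destruct Hmp as [H|H]; [auto|right; left; split; [assumption|]].
        rewrite <- subterm_root, replace_at by assumption. discriminate.
      + left. destruct Hmp as [H|H].
        * destruct (classic (m b (p ++ j :: r) = None)) as [H'|H']; [assumption|].
          apply (wf_prefix Hmw) in H'; contradiction.
        * apply (wf_leaf Hmw H); [reflexivity|discriminate].
    - rewrite replace_other by assumption. apply Hub; eauto. }
  assert (Hrp : replace u p bot p = Some (Bot F)).
  { rewrite <- subterm_root, replace_at by assumption. reflexivity. }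
  destruct (Hle p) as [H|[[H _]|H]]; congruence.
Qed.

Lemma p_stable ts ps : reduction ar B lt ts ps ->
  (forall lam, is_limit lt lam ->
     is_liminf ar lt (fun i => replace (ts (Some i)) (ps i) bot) lam (ts lam)) ->
  forall x g p, leO (Some g) x -> avoids ps (fun q => prefix q p) (Some g) x ->
    ts (Some g) p <> None -> ts x p = ts (Some g) p.
Proof.
  intros Hred Hp x; induction (ltO_wf x) as [x _ IH]. intros g p [->|Hg] Hav Hdef; [reflexivity|].
  destruct (ord_cases x) as [Hmin|[[i Hi]|Hl]].
  - destruct (ltO_irrefl (x := x)). eapply leO_ltO; [apply Hmin|exact Hg].
  - pose proof (succ_le Hi Hg) as Hgi. pose proof (ts_step Hred Hi) as Hs. destruct Hi as [Hi _].
    rewrite (step_label (ts_wf Hred _) Hs); [|now apply Hav].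
    apply IH; auto. eapply avoids_weaken; eauto; [apply leO_refl|now right].
  - assert (Hcw : forall i, wf (replace (ts (Some i)) (ps i) bot)).
    { intros i; apply wf_replace; [apply (ts_wf Hred)|apply wf_bot|apply (ps_defined Hred)]. }
    assert (Hsame : forall i q, leO (Some g) (Some i) -> ltO (Some i) x -> prefix q p ->
      replace (ts (Some i)) (ps i) bot q = ts (Some g) q).
    { intros i q Hi Hix Hq. rewrite replace_other; [|apply (ts_wf Hred)|].
      - apply IH; auto.
        + intros j H1 H2 H3. apply (Hav j H1); [eapply ltO_trans; eauto|].
          eapply prefix_trans; eauto.
        + destruct Hq as [r ->]. eapply wf_prefix; [apply (ts_wf Hred)|eassumption].
      - intros H. apply (Hav i Hi Hix). eapply prefix_trans; eauto. }
    destruct (liminf_stable (Hp x Hl) Hcw (ts_wf Hred _) Hdef Hg Hsame) as [H1 H2].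
    destruct (classic (ts (Some g) p = Some (Bot F))) as [Hb|Hb]; [|auto].
    destruct (liminf_bot (p := p) (Hp x Hl)) as [H|H]; [|congruence..].
    intros b Hb'.
    destruct (ltO_total (Some b) (Some g)) as [H|[H|H]].
    + exists g; splits; [now right|assumption|].
      rewrite Hsame; auto using leO_refl, prefix_refl.
    + exists g; splits; [now left|assumption|].
      rewrite Hsame; auto using leO_refl, prefix_refl.
    + exists b; splits; [apply leO_refl|assumption|].
      rewrite Hsame; auto using prefix_refl. now right.
Qed.

Lemma p_limit_behaviour ts ps : reduction ar R lt ts ps ->
  (forall lam, is_limit lt lam ->
     is_liminf ar lt (fun i => replace (ts (Some i)) (ps i) bot) lam (ts lam)) ->
  limit_behaviour ts ps.
Proof.
  intros HredR Hp lam b p Hl Hb Hav Hdef.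
  assert (Hred : reduction ar B lt ts ps).
  { destruct HredR as (H1 & H2 & H3); split; [assumption|split; [assumption|]].
    intros i y Hi; apply (step_mono (S := R)); [now left|auto]. }
  destruct (classic (exists c, leO (Some b) (Some c) /\ ltO (Some c) lam /\
       avoids ps (fun q => prefix q p) (Some c) lam)) as [(c & Hbc & Hc & Hav')|Hn].
  - left; exists c; splits; auto.
    (* Before [c] the position [p] itself may be contracted, but nothing above it is; the stable
       label of the parent keeps [p] defined. *)
    assert (Hpar : forall x, leO (Some b) x -> leO x lam -> ts x p <> None).
    { intros x Hbx Hxl. destruct p as [|i p _] using rev_ind; [exact (proj1 (ts_wf Hred x))|].
      apply (proj2 (ts_wf Hred x)). apply (proj2 (ts_wf Hred (Some b))) in Hdef as (a & Ha & Hi).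
      exists a; split; [|assumption]. rewrite <- Ha. apply (p_stable Hred Hp); auto; [|congruence].
      intros j H1 H2 H3. apply (Hav j H1); [eapply ltO_leO; eauto|].
      split.
      - eapply prefix_trans; [exact H3|]. now exists [i].
      - intros E; rewrite E in H3. apply prefix_length in H3. rewrite length_app in H3; cbn in H3; lia. }
    apply (p_stable Hred Hp); auto; [now right|]. apply Hpar; [assumption|now right].
  - right.
    (* Contractions strictly above [p] being excluded, one at a prefix of [p] is one at [p]. *)
    assert (Hcof : forall c, leO (Some b) (Some c) -> ltO (Some c) lam ->
      exists i, leO (Some c) (Some i) /\ ltO (Some i) lam /\ ps i = p).
    { intros c Hbc Hc. apply NNPP; intros Hn'. apply Hn; exists c; splits; auto.
      intros i H1 H2 H3. apply Hn'; exists i; splits; auto. apply NNPP; intros Hne.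
      apply (Hav i); [eapply leO_trans; eauto|assumption|now split]. }
    split.
    + destruct (liminf_bot (p := p) (Hp lam Hl)) as [H|H]; [|exfalso|assumption].
      * intros c Hc.
        destruct (ltO_max Hb Hc) as (d & Hbd & Hcd & Hd).
        destruct (Hcof d Hbd Hd) as (i & Hi & Hil & Hpi). exists i; splits.
        -- eapply leO_trans; eauto.
        -- assumption.
        -- rewrite <- Hpi, <- subterm_root, replace_at;
             [reflexivity|apply (ts_wf Hred)|apply (ps_defined Hred)].
      * revert H. destruct p as [|i p _] using rev_ind; [exact (proj1 (ts_wf Hred lam))|].
        apply (proj2 (ts_wf Hred lam)). apply (proj2 (ts_wf Hred (Some b))) in Hdef as (a & Ha & Hi).
        exists a; split; [|assumption]. rewrite <- Ha.
        apply (p_stable Hred Hp); auto; [now right| |congruence].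
        intros j H1 H2 H3. apply (Hav j H1 H2). split.
        -- eapply prefix_trans; [exact H3|]. now exists [i].
        -- intros E; rewrite E in H3. apply prefix_length in H3.
           rewrite length_app in H3; cbn in H3; lia.
    + intros c Hbc Hc. destruct (Hcof c Hbc Hc) as (i & Hi & Hil & Hpi).
      destruct (succ_exists Hil) as (y & Hy & _).
      exists i, y; splits; auto. now apply HredR.
Qed.

(** * Limits inferior *)

(* Glb of a nonempty set [T] of terms, [v0] in [T]: labels are kept as long as all of [T]
   agrees, and the first disagreement is cut off by bottom. *)
Section Glb.
Variable T : term -> Prop.
Variable v0 : term.
Hypothesis Tv0 : T v0.
Hypothesis T_wf : forall v, T v -> wf v.

Definition agree (p : pos) : Prop := forall v, T v -> v p = v0 p.

Definition glb : term := fun p =>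
  if excluded_middle_informative (forall q, strict_prefix q p -> agree q)
  then if excluded_middle_informative (agree p) then v0 p else Some (Bot F)
  else None.

Lemma strict_prefix_of_snoc q p i : prefix q p -> strict_prefix q (p ++ [i]).
Proof.
  intros H; split; [eapply prefix_trans; [exact H|now exists [i]]|].
  intros ->. apply prefix_length in H. rewrite length_app in H; cbn in H; lia.
Qed.

Lemma disagree_defined p i : agree p -> ~ agree (p ++ [i]) ->
  exists a, v0 p = Some a /\ i < arity a.
Proof.
  intros Hp Hn. apply not_all_ex_not in Hn as [v Hn]. apply imply_to_and in Hn as [Hv Hn].
  destruct (v0 (p ++ [i])) eqn:E.
  - apply (proj2 (T_wf Tv0)); congruence.
  - rewrite <- (Hp v Hv). apply (proj2 (T_wf Hv)); congruence.
Qed.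

Lemma glb_lower v : T v -> pleq glb v.
Proof.
  intros Hv p; unfold glb.
  destruct (excluded_middle_informative _) as [Hs|Hs]; [|now left].
  destruct (excluded_middle_informative _) as [Ha|Ha]; right; [right; symmetry; now apply Ha|left].
  split; [reflexivity|]. destruct p as [|i p _] using rev_ind; [exact (proj1 (T_wf Hv))|].
  assert (Hp : agree p) by (apply Hs, strict_prefix_of_snoc, prefix_refl).
  apply (proj2 (T_wf Hv)). rewrite (Hp v Hv). now apply disagree_defined.
Qed.

Lemma wf_glb : wf glb.
Proof.
  split.
  - unfold glb. destruct (excluded_middle_informative _) as [_|Hs].
    + destruct (excluded_middle_informative _); [exact (proj1 (T_wf Tv0))|discriminate].
    + destruct Hs. intros q [[r Hr] Hne]. destruct q; [congruence|discriminate].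
  - intros p i. unfold glb at 1.
    assert (Hall : (forall q, strict_prefix q (p ++ [i]) -> agree q) ->
      agree p /\ glb p = v0 p).
    { intros Hs. assert (Hp : agree p) by (apply Hs, strict_prefix_of_snoc, prefix_refl).
      split; [assumption|]. unfold glb.
      destruct (excluded_middle_informative _) as [_|Hn].
      - destruct (excluded_middle_informative _); [reflexivity|contradiction].
      - destruct Hn; intros q [Hq _]; apply Hs. now apply strict_prefix_of_snoc. }
    split.
    + destruct (excluded_middle_informative _) as [Hs|_]; [|congruence].
      destruct (Hall Hs) as [Hp ->]. intros H.
      destruct (excluded_middle_informative _) as [_|Hn].
      * now apply (proj2 (T_wf Tv0)).
      * now apply disagree_defined.
    + intros (a & Ha & Hi).
      assert (Hs : forall q, strict_prefix q (p ++ [i]) -> agree q).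
      { unfold glb in Ha.
        destruct (excluded_middle_informative _) as [Hs|_]; [|congruence].
        destruct (excluded_middle_informative _) as [Hp|_].
        - intros q Hq. apply strict_prefix_snoc in Hq.
          destruct (classic (q = p)) as [->|Hne]; [assumption|]. apply Hs; now split.
        - injection Ha as <-; cbn in Hi; lia. }
      destruct (Hall Hs) as [Hp He].
      destruct (excluded_middle_informative _) as [_|Hn]; [|contradiction].
      destruct (excluded_middle_informative _) as [_|_]; [|discriminate].
      apply (proj2 (T_wf Tv0)). exists a; split; congruence.
Qed.

Lemma glb_greatest w : wf w -> (forall v, T v -> pleq w v) -> pleq w glb.
Proof.
  intros Hw Hle p. destruct (w p) as [a|] eqn:Ha; [|now left].
  assert (Hagree : forall q b, w q = Some b -> b <> Bot F -> agree q).
  { assert (H : forall q b v, w q = Some b -> b <> Bot F -> T v -> v q = w q).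
    { intros q b v Hq Hb Hv. destruct (Hle v Hv q) as [H|[[H _]|H]]; congruence. }
    intros q b Hq Hb v Hv. rewrite (H q b v), (H q b v0); auto. }
  assert (Hs : forall q, strict_prefix q p -> agree q).
  { intros q [[r ->] Hne].
    destruct (w q) as [b|] eqn:Hq.
    - apply (Hagree q b Hq). intros ->.
      rewrite (wf_leaf (q := r) Hw Hq) in Ha; [congruence|reflexivity|].
      intros ->; apply Hne; now rewrite app_nil_r.
    - destruct (wf_prefix (t := w) (p := q) (q := r) Hw); congruence. }
  unfold glb. destruct (excluded_middle_informative _) as [_|Hn]; [|contradiction].
  destruct (excluded_middle_informative _) as [_|Hn].
  - rewrite <- Ha. exact (Hle v0 Tv0 p).
  - right; left; split; [|discriminate].
    destruct (classic (a = Bot F)) as [->|Hne]; [reflexivity|].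
    destruct Hn. exact (Hagree p a Ha Hne).
Qed.
End Glb.

(** The infima of the tails serve as witnesses. Stability along paths brings each non-bottom label
    of [u] into some infimum; the cofinal bottoms prevent any infimum from exceeding [u]. *)
Lemma liminf_intro (c : I -> term) lam u :
  (forall i, wf (c i)) -> wf u -> (exists b, ltO (Some b) lam) ->
  (forall p a, u p = Some a -> a <> Bot F -> exists g, ltO (Some g) lam /\
     forall i q, leO (Some g) (Some i) -> ltO (Some i) lam -> prefix q p -> c i q = u q) ->
  (forall p b, u p = Some (Bot F) -> ltO (Some b) lam ->
     exists i, leO (Some b) (Some i) /\ ltO (Some i) lam /\ c i p = Some (Bot F)) ->
  is_liminf ar lt c lam u.
Proof.
  intros Hc Hu [b0 Hb0] Hstab Hbot.
  pose (T b := fun v => exists i, leO (Some b) (Some i) /\ ltO (Some i) lam /\ v = c i).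
  assert (HT : forall b, ltO (Some b) lam -> T b (c b)).
  { intros b Hb; exists b; splits; auto using leO_refl. }
  assert (HTw : forall b v, T b v -> wf v) by (intros b v (i & _ & _ & ->); apply Hc).
  exists (fun b => glb (T b) (c b)). split.
  { intros b Hb; split; [|split].
    - apply wf_glb; eauto.
    - intros v Hv; apply glb_lower; eauto.
    - intros w Hw Hle; apply glb_greatest; eauto. }
  split; [assumption|split].
  - intros v (b & Hb & ->).
    assert (Hmw : wf (glb (T b) (c b))) by (apply wf_glb; eauto).
    assert (Hlow : forall i, leO (Some b) (Some i) -> ltO (Some i) lam ->
      pleq (glb (T b) (c b)) (c i)).
    { intros i H1 H2. apply glb_lower; eauto. exists i; auto. }
    set (m := glb (T b) (c b)) in *.
    assert (Hval : forall p x, u p <> None -> m p = Some x -> x <> Bot F -> u p = Some x).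
    { intros p x Hup Hx Hnb.
      assert (Hcx : forall i, leO (Some b) (Some i) -> ltO (Some i) lam -> c i p = Some x).
      { intros i H1 H2. destruct (Hlow i H1 H2 p) as [H|[[H _]|H]]; congruence. }
      destruct (u p) as [y|] eqn:Hy; [|congruence].
      destruct (classic (y = Bot F)) as [->|Hne].
      - destruct (Hbot p b Hy Hb) as (i & H1 & H2 & H3). rewrite Hcx in H3; congruence.
      - destruct (Hstab p y Hy Hne) as (g & Hg & Hgs).
        destruct (ltO_max Hb Hg) as (d & Hbd & Hgd & Hd).
        rewrite <- Hy, <- (Hgs d p), Hcx; auto using prefix_refl. }
    assert (Hdef : forall p, m p <> None -> u p <> None).
    { intros p; induction p as [|i p IH] using rev_ind; intros Hp; [exact (proj1 Hu)|].
      apply (proj2 Hmw) in Hp as (a & Ha & Hi). apply (proj2 Hu). exists a; split; [|assumption].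
      apply Hval; [apply IH; congruence|assumption|]. intros ->; cbn in Hi; lia. }
    intros p. destruct (m p) as [x|] eqn:Hx; [right|now left].
    assert (Hup : u p <> None) by (apply Hdef; congruence).
    destruct (classic (x = Bot F)) as [->|Hne]; [now left|right].
    now rewrite (Hval p x).
  - intros w Hw Hle.
    assert (Hval : forall p a, u p = Some a -> a <> Bot F -> w p = Some a).
    { intros p a Ha Hne. destruct (Hstab p a Ha Hne) as (g & Hg & Hgs).
      assert (Hup : u p <> None) by congruence.
      assert (H1 : pleq (trunc u p) (glb (T g) (c g))).
      { apply glb_greatest; eauto using wf_trunc. intros v (i & Hi & Hil & ->).
        apply trunc_le; auto. }
      pose proof (trunc_end Hu Hup) as He.
      assert (H2 : pleq (glb (T g) (c g)) w) by (apply Hle; eauto).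
      destruct (H1 p) as [H|[[H H']|H]]; [congruence..|].
      destruct (H2 p) as [K|[[K K']|K]]; congruence. }
    intros p. destruct (u p) as [a|] eqn:Ha; [right|now left].
    destruct (classic (a = Bot F)) as [->|Hne]; [left; split; [reflexivity|]|right].
    + destruct p as [|i p _] using rev_ind; [exact (proj1 Hw)|].
      assert (Hup : u (p ++ [i]) <> None) by congruence.
      apply (proj2 Hu) in Hup as (b & Hb & Hi). apply (proj2 Hw). exists b; split; [|assumption].
      apply Hval; [assumption|]. intros ->; cbn in Hi; lia.
    + now rewrite (Hval p a).
Qed.

Lemma reduction_wf S ts ps s : reduction ar S lt ts ps -> starts_at lt ts s ->
  wf s /\ wf (ts None).
Proof.
  intros (_ & Hw & _) Hs. destruct least_index as [x Hx]. rewrite <- (Hs x Hx). auto.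
Qed.
End Ordinal.

Lemma m_conv_red s t : m_conv ar B s t -> wf s /\ wf t /\ red s t.
Proof.
  intros (I & lt & ts & ps & Hred & Hstart & <- & Hlim).
  destruct (reduction_wf (proj1 Hred) Hred Hstart); splits; try assumption.
  eapply red_of_reduction; eauto; [apply Hred|].
  apply m_limit_behaviour; auto. apply Hred.
Qed.

Lemma p_conv_red s t : p_conv ar R s t -> wf s /\ wf t /\ red s t.
Proof.
  intros (I & lt & ts & ps & Hred & Hstart & <- & Hlim).
  destruct (reduction_wf (proj1 Hred) Hred Hstart); splits; try assumption.
  eapply red_of_reduction with (ps := ps); eauto; [apply Hred| |].
  - destruct Hred as (H1 & H2 & H3); split; [assumption|split; [assumption|]].
    intros i y Hi; apply (step_mono (S := R)); [now left|auto].
  - apply p_limit_behaviour; auto. apply Hred.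
Qed.

(** * Realisation in omega steps *)

Section Omega.
Variable S : trs F.
Variable P : term -> Prop.
Hypothesis wf_S : wf_trs S.
(* [P] stands for an infinite root reduction: it can be resumed after another root step. *)
Hypothesis P_root : forall s, wf s -> P s -> exists L s', path S P s L s' /\ In [] (map fst L).

(** Above depth [n] the symbols of [s] are final, except that a subterm bound to collapse is merely
    required to keep [P]. *)
Fixpoint stable (n : nat) (s t : term) : Prop :=
  match n with
  | 0 => infred S P s t
  | Datatypes.S n => (t = bot /\ P s) \/ same_node (stable n) s t
  end.

Lemma same_node_impl (X Y : term -> term -> Prop) s t :
  (forall u v, X u v -> Y u v) -> same_node X s t -> same_node Y s t.
Proof. intros H [H0 Hc]; split; eauto. Qed.

Lemma stable_pred n s t : stable (Datatypes.S n) s t -> stable n s t.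
Proof.
  revert s t; induction n as [|n IH]; intros s t [Hb|Hn].
  - apply infred_fold; now left.
  - apply infred_fold; right; exists s; split; [apply rt_refl|assumption].
  - now left.
  - right; revert Hn; apply same_node_impl; exact IH.
Qed.

(** The witness [s] only records that [P] is inhabited: for the empty [P] of the Böhm side no
    position is collapsing, and the estimates below become metric ones. *)
Definition collapsing (t : term) (p : pos) : Prop :=
  exists q s, prefix q p /\ t q = Some (Bot F) /\ P s.

Lemma collapsing_child t i p : collapsing (sub t i) p -> collapsing t (i :: p).
Proof.
  intros (q & s & H1 & H2 & H3). exists (i :: q), s; splits; auto using prefix_cons.
Qed.

Lemma stable_label n s t : wf s -> wf t -> stable n s t ->
  forall p, length p < n -> t p = s p \/ collapsing t p.
Proof.
  revert s t; induction n as [|n IH]; intros s t Hs Ht Hst p Hp; [lia|].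
  destruct Hst as [[-> Hb]|[H0 Hc]].
  - right; exists [], s; splits; auto using prefix_nil.
  - destruct p as [|i p]; [auto|]. destruct (wf_root Ht) as [a Ha].
    assert (Hsa : s [] = Some a) by congruence.
    destruct (le_lt_dec (arity a) i) as [Hi|Hi].
    + left. rewrite (wf_out p Ht Ha Hi), (wf_out p Hs Hsa Hi). reflexivity.
    + cbn in Hp.
      destruct (IH (sub s i) (sub t i) (wf_child Hs Hsa Hi) (wf_child Ht Ha Hi) (Hc a i Ha Hi) p)
        as [H|H]; [lia|left; exact H|right; now apply collapsing_child].
Qed.

Definition good_steps (n : nat) (t : term) (L : list (pos * term)) : Prop :=
  forall p, In p (map fst L) -> n <= length p \/ collapsing t p.

(** For the limit inferior, a bottom of [t] has to show up as bottom again and again; each stage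
    provides an occasion, since a contracted position counts as bottom. *)
Definition serves (n : nat) (t : term) (L : list (pos * term)) (s' : term) : Prop :=
  forall p, t p = Some (Bot F) -> length p <= n -> s' p = Some (Bot F) \/ In p (map fst L).

Lemma path_wf (Q : term -> Prop) s L s' : wf s -> path S Q s L s' ->
  path S (fun v => wf v /\ Q v) s L s'.
Proof.
  intros Hs H; revert Hs; induction H as [s HQ|s p s1 L s' HQ Hst Hp IH]; intros Hs.
  - constructor; auto.
  - econstructor; eauto. apply IH. exact (step_wf wf_S Hs Hst).
Qed.

Lemma advance n s t : wf s -> wf t -> stable n s t ->
  exists L s', path S (fun v => wf v /\ stable n v t) s L s' /\ stable (Datatypes.S n) s' t /\
    good_steps n t L /\ serves n t L s'.
Proof.
  assert (Hcollapse : forall n s, wf s -> P s ->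
    exists L s', path S (fun v => wf v /\ stable n v bot) s L s' /\
      stable (Datatypes.S n) s' bot /\ good_steps n bot L /\ serves n bot L s').
  { clear s n. intros n s Hs Hb. destruct (P_root Hs Hb) as (L & s' & HL & Hin).
    exists L, s'; splits.
    - eapply path_impl; [|exact (path_wf Hs HL)]. intros v [Hv HP]; split; [assumption|].
      apply stable_pred. left; auto.
    - left; split; [reflexivity|exact (path_end HL)].
    - intros p _. right; exists [], s; splits; auto using prefix_nil.
    - intros [|i p] H _; [now right|discriminate]. }
  revert s t; induction n as [|n IH]; intros s t Hs Ht Hst.
  - destruct (infred_unfold Hst) as [[-> Hb]|(s' & Hs' & Hn)]; [now apply Hcollapse|].
    destruct (rtc_path (Q := fun v => infred S P v t) Hs') as [L HL].
    { intros v _ Hv. apply infred_fold; right; exists s'; auto. }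
    exists L, s'; splits.
    + exact (path_wf Hs HL).
    + now right.
    + intros p _; left; lia.
    + intros [|i p] H Hl; [left; now rewrite (proj1 Hn)|cbn in Hl; lia].
  - destruct Hst as [[-> Hb]|[H0 Hc]]; [now apply Hcollapse|].
    destruct (wf_root Ht) as [a Ha]. assert (Hsa : s [] = Some a) by congruence.
    assert (Hch : forall i, exists Lw : list (pos * term) * term, i < arity a ->
      path S (fun v => wf v /\ stable n v (sub t i)) (sub s i) (fst Lw) (snd Lw) /\
      stable (Datatypes.S n) (snd Lw) (sub t i) /\
      good_steps n (sub t i) (fst Lw) /\ serves n (sub t i) (fst Lw) (snd Lw)).
    { intros i. destruct (lt_dec i (arity a)) as [Hi|Hi]; [|exists ([], bot); lia].
      destruct (IH (sub s i) (sub t i)) as (L & w & H).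
      - exact (wf_child Hs Hsa Hi).
      - exact (wf_child Ht Ha Hi).
      - exact (Hc a i Ha Hi).
      - exists (L, w); auto. }
    apply ClassicalEpsilon.choice in Hch as [Lw HLw].
    destruct (path_children (S := S) (a := a) (s := s) (L := fun i => fst (Lw i))
      (w := fun i => snd (Lw i)) (Q := fun i v => wf v /\ stable n v (sub t i)) wf_S Hs Hsa)
      as (L' & HL' & Hin).
    { intros i Hi; now apply HLw. }
    exists L', (node a (fun i => snd (Lw i))); splits.
    + eapply path_impl; [|exact HL']. intros v (Hv & Hva & Hvc). split; [assumption|].
      right; split; [congruence|]. intros b i Hb Hi. assert (b = a) by congruence; subst b.
      now apply Hvc.
    + right; split; [now rewrite Ha|]. intros b i Hb Hi.
      assert (b = a) by congruence; subst b. rewrite node_sub by assumption. now apply HLw.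
    + intros p Hp. apply Hin in Hp as (i & p' & Hi & -> & Hp').
      destruct (HLw i Hi) as (_ & _ & Hg & _).
      destruct (Hg p' Hp') as [H|H]; [left; cbn; lia|right; now apply collapsing_child].
    + intros [|i p] Hp Hl; [left; cbn; congruence|].
      destruct (le_lt_dec (arity a) i) as [Hi|Hi].
      { rewrite (wf_out p Ht Ha Hi) in Hp; congruence. }
      destruct (HLw i Hi) as (_ & _ & _ & Hsv). cbn in Hl.
      destruct (Hsv p Hp) as [H|H]; [lia| |].
      * left; cbn. destruct (lt_dec i (arity a)); [assumption|lia].
      * right; apply Hin; exists i, p; auto.
Qed.

Lemma stages s t : wf s -> wf t -> infred S P s t ->
  exists (x : nat -> term) (L : nat -> list (pos * term)), x 0 = s /\
    forall n, path S (fun v => wf v /\ stable n v t) (x n) (L n) (x (Datatypes.S n)) /\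
      good_steps n t (L n) /\ serves n t (L n) (x (Datatypes.S n)).
Proof.
  intros Hs Ht Hst.
  assert (Hg : forall nv : nat * term, exists Lv : list (pos * term) * term,
    wf (snd nv) -> stable (fst nv) (snd nv) t ->
    path S (fun v => wf v /\ stable (fst nv) v t) (snd nv) (fst Lv) (snd Lv) /\
      stable (Datatypes.S (fst nv)) (snd Lv) t /\
      good_steps (fst nv) t (fst Lv) /\ serves (fst nv) t (fst Lv) (snd Lv)).
  { intros [n v]; cbn. destruct (classic (wf v /\ stable n v t)) as [[Hv Hvt]|Hn].
    - destruct (advance Hv Ht Hvt) as (L & v' & H). exists (L, v'); auto.
    (* An arbitrary value outside the invariant: choice requires a total function. *)
    - exists ([], v); tauto. }
  apply ClassicalEpsilon.choice in Hg as [G HG].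
  pose (x := fix x n := match n with 0 => s | Datatypes.S n => snd (G (n, x n)) end).
  assert (Hx : forall n, wf (x n) /\ stable n (x n) t).
  { induction n as [|n [IH1 IH2]]; [auto|].
    destruct (HG (n, x n) IH1 IH2) as (H1 & H2 & _). split; [|exact H2].
    exact (proj1 (path_end H1)). }
  exists x, (fun n => fst (G (n, x n))); split; [reflexivity|]. intros n.
  destruct (Hx n) as [H1 H2]. destruct (HG (n, x n) H1 H2) as (H3 & _ & H4 & H5). auto.
Qed.

(** * Concatenation of the stages into one sequence *)

Section Flatten.
Variable Q : nat -> term -> Prop.
Variable x : nat -> term.
Variable L : nat -> list (pos * term).
Hypothesis Hpath : forall n, path S (Q n) (x n) (L n) (x (Datatypes.S n)).

(* State of the flattened reduction: stage, current term, remaining steps of the stage. *)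
Definition next (st : nat * term * list (pos * term)) : nat * term * list (pos * term) :=
  match st with
  | (n, v, []) => (Datatypes.S n, v, L (Datatypes.S n))
  | (n, _, (_, v) :: l) => (n, v, l)
  end.

Definition state (k : nat) : nat * term * list (pos * term) := Nat.iter k next (0, x 0, L 0).
Definition stage (k : nat) : nat := fst (fst (state k)).
Definition cur (k : nat) : term := snd (fst (state k)).
(** [None] marks the idle tick that ends a stage, so that time passes even through empty stages. *)
Definition act (k : nat) : option pos :=
  match snd (state k) with [] => None | (p, _) :: _ => Some p end.

Lemma state_inv k : match state k with (n, v, l) =>
  path S (Q n) v l (x (Datatypes.S n)) /\ exists l0, L n = l0 ++ l end.
Proof.
  induction k as [|k IH]; [split; [apply Hpath|now exists []]|].
  change (state (Datatypes.S k)) with (next (state k)).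
  revert IH; destruct (state k) as [[n v] [|[p v'] l]]; cbn; intros [IH [l0 Hl0]].
  - inversion IH; subst. split; [apply Hpath|now exists []].
  - inversion IH; subst. split; [assumption|]. exists (l0 ++ [(p, v')]).
    now rewrite <- app_assoc.
Qed.

Lemma cur_inv k : Q (stage k) (cur k).
Proof.
  pose proof (state_inv k) as H. unfold stage, cur.
  revert H; destruct (state k) as [[n v] l]; intros H. exact (path_start (proj1 H)).
Qed.

Lemma cur_step k : match act k with
  | Some p => step S (cur k) p (cur (Datatypes.S k))
  | None => cur (Datatypes.S k) = cur k end.
Proof.
  pose proof (state_inv k) as H. unfold cur, act.
  change (state (Datatypes.S k)) with (next (state k)).
  revert H; destruct (state k) as [[n v] [|[p v'] l]]; cbn; [reflexivity|].
  intros [H _]; now inversion H.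
Qed.

Lemma act_in k p : act k = Some p -> In p (map fst (L (stage k))).
Proof.
  pose proof (state_inv k) as H. unfold stage, act.
  revert H; destruct (state k) as [[n v] [|[p' v'] l]]; cbn; [discriminate|].
  intros [_ [l0 ->]] [= ->]. rewrite map_app, in_app_iff; right; now left.
Qed.

Lemma stage_mono k j : k <= j -> stage k <= stage j.
Proof.
  induction 1 as [|j _ IH]; [lia|]. etransitivity; [exact IH|]. unfold stage.
  change (state (Datatypes.S j)) with (next (state j)).
  destruct (state j) as [[n v] [|[p v'] l]]; cbn; lia.
Qed.

Lemma state_finish l : forall k n v, state k = (n, v, l) ->
  (exists j, state j = (Datatypes.S n, x (Datatypes.S n), L (Datatypes.S n))) /\
  forall p, In p (map fst l) -> exists j, stage j = n /\ act j = Some p.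
Proof.
  induction l as [|[p v'] l IH]; intros k n v Hk.
  - split; [|intros p []]. exists (Datatypes.S k).
    change (state (Datatypes.S k)) with (next (state k)). rewrite Hk; cbn.
    pose proof (state_inv k) as H; rewrite Hk in H. destruct H as [H _]; now inversion H.
  - destruct (IH (Datatypes.S k) n v') as [H1 H2].
    { change (state (Datatypes.S k)) with (next (state k)). now rewrite Hk. }
    split; [exact H1|]. intros q [<-|Hq]; [|auto].
    exists k; unfold stage, act; now rewrite Hk.
Qed.

Lemma state_start n : exists k, state k = (n, x n, L n).
Proof.
  induction n as [|n [k Hk]]; [now exists 0|]. exact (proj1 (state_finish Hk)).
Qed.

Lemma stage_late n : exists k, forall j, k <= j -> n <= stage j.
Proof.
  destruct (state_start n) as [k Hk]. exists k; intros j Hj.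
  apply stage_mono in Hj. unfold stage in Hj at 1. now rewrite Hk in Hj.
Qed.
End Flatten.

Lemma omega_reduction s t : wf s -> wf t -> infred S P s t ->
  exists (u : nat -> term) (a : nat -> option pos), u 0 = s /\ (forall k, wf (u k)) /\
    (forall k, match a k with
               | Some p => step S (u k) p (u (Datatypes.S k))
               | None => u (Datatypes.S k) = u k end) /\
    (forall n, exists k0, forall k, k0 <= k ->
       (forall p, length p < n -> t p = u k p \/ collapsing t p) /\
       (forall p, a k = Some p -> n <= length p \/ collapsing t p)) /\
    (forall p, t p = Some (Bot F) -> forall k0, exists k, k0 <= k /\
       (u k p = Some (Bot F) \/ a k = Some p)).
Proof.
  intros Hs Ht Hst. destruct (stages Hs Ht Hst) as (x & L & Hx0 & HL).
  assert (Hp : forall n, path S (fun v => wf v /\ stable n v t) (x n) (L n) (x (Datatypes.S n)))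
    by apply HL.
  exists (cur x L), (act x L); splits.
  - exact Hx0.
  - intros k; apply (cur_inv Hp k).
  - intros k; apply (cur_step Hp k).
  - intros n. destruct (stage_late Hp n) as [k0 Hk0]. exists k0; intros k Hk.
    specialize (Hk0 k Hk). destruct (cur_inv Hp k) as [Hw Hstb]. split.
    + intros p Hl. apply (stable_label Hw Ht Hstb). lia.
    + intros p Ha. apply (act_in Hp) in Ha. destruct (HL (stage x L k)) as (_ & Hg & _).
      destruct (Hg p Ha) as [H|H]; [left; lia|now right].
  - intros p Hpb k0.
    (* At least [length p], so that stage [n] serves [p]; beyond the stage of [k0], so that this
       happens after [k0]. *)
    pose (n := max (length p) (Datatypes.S (stage x L k0))).
    assert (Hlate : forall k, n <= stage x L k -> k0 <= k).
    { intros k Hk. destruct (le_lt_dec k0 k) as [H|H]; [assumption|].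
      assert (Hm : stage x L k <= stage x L k0) by (apply (@stage_mono x L); lia). lia. }
    destruct (HL n) as (_ & _ & Hsv). destruct (state_start Hp n) as [k Hk].
    destruct (state_finish Hp Hk) as [[j Hj] Hin].
    destruct (Hsv p Hpb) as [H|H]; [lia| |].
    + exists j; split; [|left; unfold cur; now rewrite Hj].
      apply Hlate. unfold stage; rewrite Hj; cbn; lia.
    + destruct (Hin p H) as (i & Hi & Hai). exists i; split; [|now right].
      apply Hlate; lia.
Qed.
End Omega.

(** * From sequences with idle ticks to reductions *)

Section Sequence.
Variable S : trs F.
Variable u : nat -> term.
Variable a : nat -> option pos.
Variable t : term.
Hypothesis u_wf : forall k, wf (u k).
Hypothesis t_wf : wf t.
Hypothesis u_step : forall k, match a k with
  | Some p => step S (u k) p (u (Datatypes.S k))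
  | None => u (Datatypes.S k) = u k end.
Hypothesis u_final : forall k0, (forall k, k0 <= k -> a k = None) -> u k0 = t.

(** Restricting the indices to the ticks that contract something covers finite length and length
    omega at once; in the finite case [u_final] makes [t] the last term. *)
Definition active : Type := {k : nat | a k <> None}.
Definition idx (i : active) : nat := proj1_sig i.
Definition lt_active (i j : active) : Prop := idx i < idx j.
Definition term_at (x : option active) : term := match x with Some i => u (idx i) | None => t end.
Definition pos_at (i : active) : pos := match a (idx i) with Some p => p | None => [] end.

Lemma idx_inj i j : idx i = idx j -> i = j.
Proof.
  destruct i as [k Hk], j as [k' Hk']; cbn; intros <-. f_equal; apply proof_irrelevance.
Qed.

Lemma active_wellorder : wellorder lt_active.
Proof.
  split.
  - apply (well_founded_lt_compat _ idx). auto.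
  - intros i j k; unfold lt_active; lia.
  - intros i j; unfold lt_active. destruct (lt_eq_lt_dec (idx i) (idx j)) as [[H|H]|H]; auto.
    right; left; now apply idx_inj.
Qed.

Lemma idle_eq k j : k <= j -> (forall i, k <= i -> i < j -> a i = None) -> u j = u k.
Proof.
  induction 1 as [|j Hkj IH]; intros Hidle; [reflexivity|].
  pose proof (u_step j) as Hs. rewrite Hidle in Hs by lia. rewrite Hs. apply IH.
  intros i H1 H2; apply Hidle; lia.
Qed.

Lemma pos_at_eq i : a (idx i) = Some (pos_at i).
Proof.
  pose proof (proj2_sig i) as H; cbn in H. fold (idx i) in H.
  unfold pos_at. destruct (a (idx i)); congruence.
Qed.

Lemma active_step i : step S (u (idx i)) (pos_at i) (u (Datatypes.S (idx i))).
Proof.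
  pose proof (u_step (idx i)) as H. now rewrite pos_at_eq in H.
Qed.

Lemma active_next x y : (forall k (H : a k <> None), x <= k -> ~ ltO lt_active (Some (exist _ k H)) y) ->
  (forall j, y = Some j -> x <= idx j) -> term_at y = u x.
Proof.
  intros Hn Hy. destruct y as [j|]; cbn.
  - apply idle_eq; [now apply Hy|]. intros k H1 H2. apply NNPP; intros Hk.
    exact (Hn k Hk H1 H2).
  - symmetry; apply u_final. intros k Hk. apply NNPP; intros Hak. exact (Hn k Hak Hk I).
Qed.

Lemma active_reduction : reduction ar S lt_active term_at pos_at.
Proof.
  split; [exact active_wellorder|split].
  - intros [i|]; [apply u_wf|exact t_wf].
  - intros i y [Hlt Hbetween].
    rewrite (active_next (x := Datatypes.S (idx i)) (y := y)).
    + apply active_step.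
    + intros k Hk Hle H. apply (Hbetween (Some (exist _ k Hk))); [|assumption].
      exact Hle.
    + intros j ->; exact Hlt.
Qed.

Lemma active_starts : starts_at lt_active term_at (u 0).
Proof.
  intros x Hx. apply active_next; [|intros; lia].
  intros k Hk _ H. destruct (Hx (Some (exist _ k Hk))) as [->|H'].
  - exact (ltO_irrefl active_wellorder H).
  - exact (ltO_irrefl active_wellorder (ltO_trans active_wellorder H H')).
Qed.

(** Only finitely many ticks precede a given one, so the end is the only possible limit. *)
Lemma active_limit lam : is_limit lt_active lam ->
  lam = None /\ forall k0, exists i : active, k0 <= idx i.
Proof.
  intros [[x Hx] Hl]. destruct lam as [j|].
  - exfalso. assert (H : forall d i, idx j - idx i <= d -> ltO lt_active (Some i) (Some j) -> False).
    { induction d as [|d IH]; intros i Hd Hi; [cbn in Hi; unfold lt_active in Hi; lia|].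
      destruct (Hl _ Hi) as ([k|] & H1 & H2); [|exact H2].
      apply (IH k); [cbn in H1, H2, Hi; unfold lt_active in *; lia|assumption]. }
    destruct x as [i|]; [|exact Hx]. exact (H _ i (le_n _) Hx).
  - split; [reflexivity|]. induction k0 as [|k0 [i Hi]].
    + destruct x as [i|]; [|destruct Hx]. exists i; lia.
    + destruct (Hl (Some i) I) as ([j|] & H1 & H2); [|destruct H2].
      exists j; cbn in H1; unfold lt_active in H1; lia.
Qed.
End Sequence.

(** * From coinductive reductions to both kinds of convergence *)

Lemma infred_m_conv s t : wf s -> wf t -> infred B (fun _ => False) s t -> m_conv ar B s t.
Proof.
  intros Hs Ht Hst.
  destruct (omega_reduction wf_bohm (P := fun _ => False)) with (s := s) (t := t)
    as (u & a & Hu0 & Hw & Hstep & Hconv & _); auto; [contradiction|].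
  assert (Hfin' : forall k0, (forall k, k0 <= k -> a k = None) -> u k0 = t).
  { intros k0 Hk0. apply term_ext; intros p.
    destruct (Hconv (Datatypes.S (length p))) as [k1 Hk1].
    destruct (Hk1 (k0 + k1)) as [H _]; [lia|].
    destruct (H p) as [E|(? & ? & _ & _ & [])]; [lia|]. rewrite E.
    symmetry; apply (f_equal (fun f => f p)). apply (idle_eq Hstep); [lia|].
    intros; apply Hk0; lia. }
  exists (active a), (lt_active (a := a)), (term_at (a := a) u t), (pos_at (a := a)); splits.
  - now apply active_reduction.
  - rewrite <- Hu0. now apply (active_starts (S := B)).
  - reflexivity.
  - intros lam Hl n. destruct (active_limit Hl) as [-> Hinf].
    destruct (Hconv (Datatypes.S n)) as [k0 Hk0]. destruct (Hinf k0) as [b Hb].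
    exists b; split; [exact I|]. intros i Hbi _.
    assert (Hi : k0 <= idx i).
    { destruct Hbi as [E|H]; [injection E as ->; exact Hb|cbn in H; unfold lt_active in H; lia]. }
    destruct (Hk0 _ Hi) as [H1 H2]. split.
    + intros p Hp. destruct (H1 p) as [E|(? & ? & _ & _ & [])]; [lia|]. symmetry; exact E.
    + destruct (H2 _ (pos_at_eq i)) as [H|(? & ? & _ & _ & [])]; lia.
Qed.

Lemma collapsing_bot P t p b : wf t -> t p = Some b -> collapsing P t p -> b = Bot F.
Proof.
  intros Ht Hp (q & _ & [r ->] & Hq & _). destruct r as [|i r].
  - rewrite app_nil_r in Hp; congruence.
  - rewrite (wf_leaf (q := i :: r) Ht Hq) in Hp; [discriminate|reflexivity|discriminate].
Qed.

Lemma inf_root_path s : wf s -> inf_root s ->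
  exists L s', path R inf_root s L s' /\ In [] (map fst L).
Proof.
  intros Hs Hrt. destruct (inf_root_unfold Hrt) as (u & v & Hu & Hv & Hrv).
  pose proof (rtc_wf wf_R Hs Hu) as Hwu.
  pose proof (inf_root_rtc (rtc_root Hwu Hv) Hrv) as Hru.
  destruct (rtc_path (Q := inf_root) Hu) as [L HL].
  (* Every term before the root step still reduces to it and so keeps [inf_root]. *)
  { intros w _ Hw. exact (inf_root_rtc Hw Hru). }
  exists (L ++ [([], v)]), v; split.
  - apply (path_app HL). apply path_cons; [assumption|now apply step_nil|now apply path_nil].
  - rewrite map_app, in_app_iff; right; now left.
Qed.

Lemma red_p_conv s t : wf s -> wf t -> red s t -> p_conv ar R s t.
Proof.
  intros Hs Ht Hst.
  destruct (omega_reduction wf_R inf_root_path Hs Ht Hst)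
    as (u & a & Hu0 & Hw & Hstep & Hconv & Hcof).
  (* A position with a non-bottom label has no bottom at any prefix, so the exception for collapsing
     positions does not apply along its path. *)
  assert (Hlabel : forall p b, t p = Some b -> b <> Bot F ->
    exists k0, forall k, k0 <= k -> (forall q, prefix q p -> u k q = t q) /\
      forall q, a k = Some q -> ~ prefix q p).
  { intros p b Hp Hb. destruct (Hconv (Datatypes.S (length p))) as [k0 Hk0].
    exists k0; intros k Hk. destruct (Hk0 k Hk) as [H1 H2].
    assert (Hnc : forall q, prefix q p -> ~ collapsing inf_root t q).
    { intros q Hq (q0 & s0 & H & H'). apply Hb.
      apply (collapsing_bot (P := inf_root) Ht Hp). exists q0, s0; split; [|assumption].
      eapply prefix_trans; eauto. }
    split.
    - intros q Hq. destruct (H1 q) as [E|H]; [apply prefix_length in Hq; lia|congruence|].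
      destruct (Hnc q Hq H).
    - intros q Hq Hqp. destruct (H2 q Hq) as [E|H]; [apply prefix_length in Hqp; lia|].
      destruct (Hnc q Hqp H). }
  assert (Hfin' : forall k0, (forall k, k0 <= k -> a k = None) -> u k0 = t).
  { intros k0 Hk0.
    assert (Hconst : forall k, k0 <= k -> u k = u k0).
    { intros k Hk. apply (idle_eq Hstep); [assumption|]. intros; now apply Hk0. }
    (* Once no contraction is left, a bottom of [t] can be served only by an actual bottom. *)
    assert (Hbot : forall p, t p = Some (Bot F) -> u k0 p = Some (Bot F)).
    { intros p Hp. destruct (Hcof p Hp k0) as (k & Hk & [E|E]).
      - now rewrite <- (Hconst k Hk).
      - rewrite Hk0 in E; congruence. }
    apply term_ext; intros p.
    destruct (Hconv (Datatypes.S (length p))) as [k1 Hk1].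
    destruct (Hk1 (k0 + k1)) as [H _]; [lia|]. rewrite Hconst in H by lia.
    destruct (H p) as [E|(q & s0 & [r ->] & Hq & _)]; [lia|congruence|].
    destruct r as [|i r].
    - rewrite app_nil_r. rewrite Hq. now apply Hbot.
    - rewrite (wf_leaf (q := i :: r) Ht Hq), (wf_leaf (q := i :: r) (Hw k0) (Hbot q Hq));
        try reflexivity; discriminate. }
  exists (active a), (lt_active (a := a)), (term_at (a := a) u t), (pos_at (a := a)); splits.
  - now apply active_reduction.
  - rewrite <- Hu0. now apply (active_starts (S := R)).
  - reflexivity.
  - intros lam Hl. destruct (active_limit Hl) as [-> Hinf].
    assert (Hle : forall i j : active a, leO (lt_active (a := a)) (Some i) (Some j) -> idx i <= idx j).
    { intros i j [E|H]; [injection E as ->; lia|cbn in H; unfold lt_active in H; lia]. }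
    assert (Hge : forall i j : active a, idx i <= idx j -> leO (lt_active (a := a)) (Some i) (Some j)).
    { intros i j H. apply (not_ltO (active_wellorder a)). cbn; unfold lt_active; lia. }
    assert (Hdef : forall i : active a, u (idx i) (pos_at i) <> None).
    { intros i. pose proof (Hstep (idx i)) as H. rewrite pos_at_eq in H.
      now destruct H as (? & ? & ? & _ & _ & H & _). }
    cbn [term_at]. apply (liminf_intro (active_wellorder a)).
    + intros i; apply wf_replace; [apply Hw|apply wf_bot|apply Hdef].
    + exact Ht.
    + destruct (Hinf 0) as [i _]; exists i; exact I.
    + intros p b Hp Hb. destruct (Hlabel p b Hp Hb) as [k0 Hk0].
      destruct (Hinf k0) as [g Hg]. exists g; split; [exact I|].
      intros i q Hi _ Hq. apply Hle in Hi. destruct (Hk0 (idx i)) as [H1 H2]; [lia|].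
      rewrite replace_other; [exact (H1 q Hq)|apply Hw|].
      intros H. apply (H2 _ (pos_at_eq i)). eapply prefix_trans; eauto.
    + intros p b Hp _.
      (* The parent of a bottom carries a non-bottom label, so contractions strictly above [p]
         cease. *)
      assert (Habove : exists k0, forall k q, k0 <= k -> a k = Some q -> ~ strict_prefix q p).
      { destruct p as [|i p _] using rev_ind.
        - exists 0; intros k q _ _ [[r Hr] Hne]. destruct q; [congruence|discriminate].
        - assert (Hpp : t (p ++ [i]) <> None) by congruence.
          apply (proj2 Ht) in Hpp as (c & Hc & Hi).
          destruct (Hlabel p c Hc) as [k0 Hk0]; [intros ->; cbn in Hi; lia|].
          exists k0; intros k q Hk Hq Hqp. apply strict_prefix_snoc in Hqp.
          exact (proj2 (Hk0 k Hk) q Hq Hqp). }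
      destruct Habove as [k0 Hk0].
      destruct (Hcof p Hp (k0 + idx b)) as (k & Hk & Hor).
      (* The tick [k] may be idle and then is no index of the reduction; the next active tick has
         the same term. *)
      assert (Hnext : exists i : active a, k <= idx i /\ u (idx i) = u k).
      { destruct (Hinf k) as [i0 Hi0]. revert Hi0.
        induction (well_founded_ltof _ (fun i => idx i) i0) as [i _ IH]. unfold ltof in IH.
        intros Hi. destruct (classic (forall j : active a, k <= idx j -> ~ idx j < idx i)) as [Hn|Hn].
        - exists i; split; [assumption|]. apply (idle_eq Hstep); [assumption|].
          intros j H1 H2. apply NNPP; intros H3. exact (Hn (exist _ j H3) H1 H2).
        - apply not_all_ex_not in Hn as [j Hn]. apply imply_to_and in Hn as [H1 H2].
          apply NNPP in H2. exact (IH j H2 H1). }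
      destruct Hor as [Hor|Hor].
      * destruct Hnext as (i & Hki & Hui). exists i; splits; [apply Hge; lia|exact I|].
        cbn [term_at].
        rewrite Hui.
        destruct (classic (pos_at i = p)) as [He|He].
        -- rewrite <- Hui, He, <- subterm_root, replace_at; [reflexivity|apply Hw|].
           rewrite <- He; apply Hdef.
        -- rewrite replace_other; [exact Hor|apply Hw|].
           intros H. apply (Hk0 (idx i) (pos_at i)); [lia|apply pos_at_eq|now split].
      * assert (Hak : a k <> None) by congruence.
        exists (exist _ k Hak); splits; [apply Hge; cbn; lia|exact I|].
        assert (He : pos_at (exist (fun k => a k <> None) k Hak) = p).
        { pose proof (pos_at_eq (exist _ k Hak)) as H; cbn in H. congruence. }
        pose proof (Hdef (exist _ k Hak)) as Hd. rewrite He in Hd |- *.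
        rewrite <- subterm_root, replace_at; [reflexivity|apply Hw|exact Hd].
Qed.

Lemma p_conv_iff_m_conv s t : p_conv ar R s t <-> m_conv ar B s t.
Proof.
  split; intros H.
  - destruct (p_conv_red H) as (Hs & Ht & Hst).
    apply infred_m_conv; auto. now apply red_infred_bohm.
  - destruct (m_conv_red H) as (Hs & Ht & Hst). now apply red_p_conv.
Qed.

End Rewriting.

Theorem theorem6p12 (F : Type) (ar : F -> nat) (R : trs F) :
  is_trs ar R -> orthogonal ar R -> left_finite R ->
  forall s t : term F, p_conv ar R s t <-> m_conv ar (bohm ar R) s t.
Proof.
  intros HR [Hlin Hno] Hfin s t. exact (p_conv_iff_m_conv HR Hlin Hno Hfin s t).
Qed.
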